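(* Let $n\ge 3$ and $m_1,\dots,m_n>0$. (i) Let $\widehat q$ be a $1$-CSBC and set $\alpha_*(\widehat q)=\max\{\alpha_j(\widehat q)\mid j=1,\dots,k\}$, where $\alpha_1(\widehat q),\dots,\alpha_k(\widehat q)$ are the multiplicities of the eigenvalues $\eta_1(\widehat q)>\dots>\eta_k(\widehat q)$ of $M_0^{-1}B(\widehat q)$ that are strictly smaller than $-U(\widehat q)$. Then for $s_1>1$ sufficiently close to $1$ and $s_2$ large enough, there exist at least $$\left\lfloor\frac{n-2}{\alpha_*(\widehat q)}\right\rfloor$$ bifurcation instants in $[s_1,s_2]$ from the trivial branch $(\widehat q_s)_{s\in[s_1,s_2]}$, $\widehat q_s\equiv\widehat q$. (ii) Consequently, for $s_1>1$ sufficiently close to $1$ and $s_2$ large enough, there are at least $$n!\cdot\left\lfloor\frac{n-2}{\alpha_*}\right\rfloor,\qquad \alpha_*=\max\{\alpha_*(\widehat q)\mid \widehat q\text{ is a }1\text{-CSBC}\},$$ bifurcation instants in $[s_1,s_2]$ from the trivial branches given by the $1$-CSBC, counted branch by branch, i.e. at least that many pairs $(\widehat q,s_* )$ with $\widehat q$ a $1$-CSBC and $s_*\in[s_1,s_2]$ a bifurcation instant from the trivial branch determined by $\widehat q$.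
   Context: Fix $n$ point masses $m_1,\dots,m_n>0$. For $q=(q_1,\dots,q_n)\in(\mathbb R^2)^n$ with $q_i\ne q_j$ for $i\neq j$, let $U(q)=\sum_{i<j}\frac{m_im_j}{|q_i-q_j|}$. Let $M=\mathrm{diag}(m_1,m_1,\dots,m_n,m_n)$ and, for $s\geq 1$, let $\widehat S(s)=\mathrm{diag}(s,1,s,1,\dots,s,1)$ (both $2n\times 2n$). Set $$\mathcal P_s=\Big\{q\in\mathbb R^{2n}\ \Big|\ \sum_{i}m_iq_i=0,\ q_i\ne q_j\ \forall i\ne j,\ \langle \widehat S(s)Mq,q\rangle=1\Big\}.$$ An $S$-balanced configuration (SBC) for the parameter $s>1$ is a critical point of $U|_{\mathcal P_s}$, equivalently a $q\in\mathcal P_s$ with $M^{-1}\nabla U(q)+U(q)\widehat S(s)q=0$. A $1$-CSBC is an SBC $\widehat q=(\widehat q_1,\dots,\widehat q_n)$ with all $\widehat q_i\in\{0\}\times\mathbb R$ (the $y$-axis). These are exactly the normalized collinear central configurations along the $y$-axis (solutions of $M^{-1}\nabla U(q)+U(q)q=0$, $\langle Mq,q\rangle=1$, on the $y$-axis); each of them belongs to $\mathcal P_s$ and is an SBC for every $s>1$, so the constant family $\widehat q_s\equiv\widehat q$ is a trivial branch of critical points. There is exactly one $1$-CSBC for each ordering of the masses along the $y$-axis. For a $1$-CSBC $\widehat q$, let $M_0=\mathrm{diag}(m_1,\dots,m_n)$ and let $B(\widehat q)$ be the symmetric $n\times n$ matrix with entries $b_{ij}=\frac{m_im_j}{|\widehat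 q_i-\widehat q_j|^3}$ for $i\ne j$ and $b_{ii}=-\sum_{j\ne i}\frac{m_im_j}{|\widehat q_i-\widehat q_j|^3}$. It is known that the matrix $M_0^{-1}B(\widehat q)$ has the simple eigenvalue $0$ (with eigenvector $(1,\dots,1)$), that its largest nonzero eigenvalue is $\eta_0(\widehat q)=-U(\widehat q)<0$, and that this eigenvalue is simple. Its distinct nonzero eigenvalues are written $\eta_k(\widehat q)<\dots<\eta_1(\widehat q)<\eta_0(\widehat q)=-U(\widehat q)$, with multiplicities $\alpha_k(\widehat q),\dots,\alpha_1(\widehat q),\alpha_0(\widehat q)=1$. For a fixed $1$-CSBC $\widehat q$ and $J=[s_1,s_2]\subset(1,\infty)$, a value $s_*\in J$ is a bifurcation instant from the trivial branch determined by $\widehat q$ if there exist a sequence $s_\ell\to s_*$ in $J$ and a sequence $q^{(\ell)}\to\widehat q$ in $\mathbb R^{2n}$ such that, for every $\ell$, $q^{(\ell)}\in\mathcal P_{s_\ell}$ is a critical point of $U|_{\mathcal P_{s_\ell}}$ and $q^{(\ell)}\ne\widehat q$. ''For $s_1>1$ sufficiently close to $1$ and $s_2$ large enough'' means: there exist $\varepsilon>0$ and $K>1+\varepsilon$ (depending on the masses and, in (i), on $\widehat q$) such that the assertion holds for all $s_1\in(1,1+\varepsilon)$ and $s_2>K$. *)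

(* Defs.v *)
From mathcomp Require Import all_boot all_order all_algebra.
From mathcomp Require Import all_classical all_reals all_analysis.

Set Implicit Arguments.
Unset Strict Implicit.
Unset Printing Implicit Defensive.

Import Order.TTheory GRing.Theory Num.Theory.
Import numFieldNormedType.Exports.

Local Open Scope classical_set_scope.
Local Open Scope ring_scope.

Section BalancedConfigurations.
Context {R : realType} {n : nat}.
Variable m : 'I_n -> R.
Implicit Types (q v : 'M[R]_(n, 2)) (s : R).

(* A configuration is an n x 2 matrix: row i is q_i, column 0 holds the
   x-coordinates and column 1 the y-coordinates. The library norm on matrices
   is the sup norm, hence the explicit Euclidean distance. *)
Definition dist q (i j : 'I_n) : R :=
  Num.sqrt ((q i 0 - q j 0) ^+ 2 + (q i 1 - q j 1) ^+ 2).

Definition potential q : R :=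
  \sum_(i < n) \sum_(j < n | (i < j)%N) m i * m j / dist q i j.

(* The bilinear form <S(s) M q, v> with S(s) = diag(s, 1, ..., s, 1) and
   M = diag(m_1, m_1, ..., m_n, m_n). *)
Definition SM_form s q v : R :=
  \sum_(i < n) m i * (s * (q i 0 * v i 0) + q i 1 * v i 1).

Definition centered q : Prop := \sum_(i < n) m i *: row i q = 0.

Definition collision_free q : Prop :=
  forall i j : 'I_n, i != j -> row i q != row j q.

Definition constraint_manifold s : set 'M[R]_(n, 2) :=
  [set q | [/\ centered q, collision_free q & SM_form s q q = 1]].

(* The tangent space at q: the kernel of the differentials of the constraints
   (the second one is half the differential of q |-> SM_form s q q). *)
Definition tangent_space s q : set 'M[R]_(n, 2) :=
  [set v | centered v /\ SM_form s q v = 0].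

(* q is a critical point of the restriction of the potential to the
   constraint manifold. *)
Definition SBC s q : Prop :=
  constraint_manifold s q /\
  forall v, tangent_space s q v -> 'D_v potential q = 0.

(* For q on the y-axis the condition SBC s q does not depend on s. *)
Definition CSBC1 q : Prop :=
  (forall i : 'I_n, q i 0 = 0) /\ exists2 s, 1 < s & SBC s q.

Definition mass_mx : 'M[R]_n := diag_mx (\row_i m i).

Definition B_mx q : 'M[R]_n :=
  \matrix_(i, j)
    if i == j then - \sum_(k < n | k != i) m i * m k / dist q i k ^+ 3
    else m i * m j / dist q i j ^+ 3.

Definition MB_mx q : 'M[R]_n := invmx mass_mx *m B_mx q.

(* The supremum of a nonempty bounded set of natural numbers is its maximum;
   here all the multiplicities are at most n. *)
Definition alpha_star q : nat :=
  supremum 0%N [set mup eta (char_poly (MB_mx q)) |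
    eta in [set eta | eigenvalue (MB_mx q) eta /\ eta < - potential q]].

Definition alpha_star_max : nat :=
  supremum 0%N [set alpha_star q | q in [set q | CSBC1 q]].

(* J is the parameter interval and the trivial branch is the constant family
   equal to q. *)
Definition bifurcation_instant (J : set R) q (sstar : R) : Prop :=
  J sstar /\
  exists (s_ : nat -> R) (q_ : nat -> 'M[R]_(n, 2)),
    [/\ forall l, J (s_ l), s_ @ \oo --> sstar, q_ @ \oo --> q
      & forall l, SBC (s_ l) (q_ l) /\ q_ l != q].

End BalancedConfigurations.

(* Main.v *)
From HB Require Import structures.
Require Import Defs.
From mathcomp Require Import all_boot all_order all_algebra.
From mathcomp Require Import all_classical all_reals all_analysis.
From mathcomp Require Import perm ring lra zify.
From mathcomp Require complex.

(** After rescaling, an SBC is a critical point of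
    [U + U(q)/2 (s |x|_M^2 + |y|_M^2)] on the whole configuration space, and at
    the collinear configuration [q = (0, y)] the Hessian of this function splits
    into the [x]-block [B + s U(q) M_0] and the positive definite [y]-block
    [-2 B + U(q) M_0]. It is therefore degenerate exactly when [- s U(q)] is an
    eigenvalue of [M_0^-1 B], and each such [s > 1] is a bifurcation instant:
    the parameter multiplies [|x|_M^2], so that, as in Krasnoselskii's theorem
    for potential operators, one may fix the size of [x] and find the
    parameter as a Lagrange multiplier. A Lyapunov-Schmidt reduction to the
    kernel turns this into minimizing a function on a ball of that kernel,
    whatever the multiplicity is.

    Below [- U(q)] there are [n - 2] eigenvalues with multiplicity, because
    [0] and [- U(q)] are simple, hence at least [(n - 2) / alpha_*] distinct
    ones. For the second part one collinear configuration for each ordering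
    of the masses is obtained by minimizing [U + |y|_M^2 / 2]. *)

Set Implicit Arguments.
Unset Strict Implicit.
Unset Printing Implicit Defensive.

Import Order.TTheory GRing.Theory Num.Theory.
Import numFieldNormedType.Exports.

Local Open Scope classical_set_scope.
Local Open Scope ring_scope.

(** * Matrices as a Euclidean space *)

(** The reduced function is never differentiated. The graph over the kernel is only Lipschitz, and
    that suffices: on it the gradient of the full function lies in the kernel, so its pairing with
    an increment sees only the kernel component, and a descent step can be tested without a
    derivative of the graph. The contraction behind the graph needs the gradient minus its linear
    part at one point to be Lipschitz with a small constant, which is strict differentiability of
    the gradient; hence [sdiff]. Minimizing under a fixed size of x would mean a constraint on the
    graph; a quadratic penalty avoids it, keeps the domain a ball and displays the multiplier.
    Translations and scaling need no quotient: solutions of the multiplier equation are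
    automatically centered, and homogeneity of U moves them to the constraint manifold.
    Nontriviality is read off the x-coordinates, which cannot all vanish at the points found. The
    instants are attached to eigenvalues and do not depend on the interval: they are finitely many
    numbers above 1, and [eps] and [K] only have to enclose them. *)

Section MatrixDot.
Context {R : realType} {m n : nat}.
Implicit Types (a b c : 'M[R]_(m, n)) (k : R).

Lemma mx_entry_le a i j : `|a i j| <= `|a|.
Proof.
rewrite [leRHS]/Num.norm /= mx_normrE.
exact: (le_bigmax _ (fun ij : 'I_m * 'I_n => `|a ij.1 ij.2|) (i, j)).
Qed.

Lemma mx_norm_le a k : 0 <= k -> (forall i j, `|a i j| <= k) -> `|a| <= k.
Proof.
move=> k0 ak; rewrite [leLHS]/Num.norm /= mx_normrE.
by apply/bigmax_leP; split=> // -[i j] _; exact: ak.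
Qed.

Definition mxdot a b : R := \tr (a^T *m b).

Lemma mxdotE a b : mxdot a b = \sum_i \sum_j a i j * b i j.
Proof.
rewrite /mxdot /mxtrace exchange_big; apply: eq_bigr => j _.
by rewrite mxE; apply: eq_bigr => i _; rewrite mxE.
Qed.

Lemma mxdotC a b : mxdot a b = mxdot b a.
Proof. by rewrite /mxdot -mxtrace_tr trmx_mul trmxK. Qed.

Lemma mxdotDr a b c : mxdot a (b + c) = mxdot a b + mxdot a c.
Proof. by rewrite /mxdot mulmxDr mxtraceD. Qed.

Lemma mxdotZr a k b : mxdot a (k *: b) = k * mxdot a b.
Proof. by rewrite /mxdot -scalemxAr mxtraceZ. Qed.

Lemma mxdotNr a b : mxdot a (- b) = - mxdot a b.
Proof. by rewrite -scaleN1r mxdotZr mulN1r. Qed.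

Lemma mxdotBr a b c : mxdot a (b - c) = mxdot a b - mxdot a c.
Proof. by rewrite mxdotDr mxdotNr. Qed.

Lemma mxdotDl a b c : mxdot (a + b) c = mxdot a c + mxdot b c.
Proof. by rewrite !(mxdotC _ c) mxdotDr. Qed.

Lemma mxdotZl a k b : mxdot (k *: a) b = k * mxdot a b.
Proof. by rewrite !(mxdotC _ b) mxdotZr. Qed.

Lemma mxdotNl a b : mxdot (- a) b = - mxdot a b.
Proof. by rewrite !(mxdotC _ b) mxdotNr. Qed.

Lemma mxdotBl a b c : mxdot (a - b) c = mxdot a c - mxdot b c.
Proof. by rewrite mxdotDl mxdotNl. Qed.

Lemma mxdot0r a : mxdot a 0 = 0.
Proof. by rewrite /mxdot mulmx0 mxtrace0. Qed.

Lemma mxdot0l a : mxdot 0 a = 0.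
Proof. by rewrite mxdotC mxdot0r. Qed.

Lemma mxdot_suml (I : Type) (r : seq I) (P : pred I) (F : I -> 'M[R]_(m, n)) b :
  mxdot (\sum_(i <- r | P i) F i) b = \sum_(i <- r | P i) mxdot (F i) b.
Proof. by elim/big_rec2: _ => [|i x y _ <-]; rewrite ?mxdot0l ?mxdotDl. Qed.

Lemma mxdot_delta i j a : mxdot (delta_mx i j) a = a i j.
Proof.
rewrite mxdotE (bigD1 i) //= (bigD1 j) //= mxE !eqxx mul1r.
rewrite !big1 ?addr0 // => [i' /negPf ni|j' /negPf nj].
  by apply: big1 => j' _; rewrite mxE ni mul0r.
by rewrite mxE nj andbF mul0r.
Qed.

Lemma mxdot_ge0 a : 0 <= mxdot a a.
Proof. by rewrite mxdotE; do 2!apply: sumr_ge0 => ? _; rewrite -expr2 sqr_ge0. Qed.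

Lemma mxdot_eq0 a : mxdot a a = 0 -> a = 0.
Proof.
move=> /eqP; rewrite mxdotE psumr_eq0; last first.
  by move=> i _; apply: sumr_ge0 => j _; rewrite -expr2 sqr_ge0.
move=> /allP a0; apply/matrixP => i j; rewrite mxE.
have := a0 i; rewrite mem_index_enum => /(_ isT).
rewrite psumr_eq0; last by move=> ? _; rewrite -expr2 sqr_ge0.
by move=> /allP/(_ j); rewrite mem_index_enum => /(_ isT); rewrite -expr2 sqrf_eq0 => /eqP.
Qed.

(** Plays the part of the Cauchy-Schwarz inequality. The norm is the sup norm and not the one
    induced by [mxdot], so the number of entries appears as a constant here and in all later
    estimates. *)
Lemma mxdot_le a b : `|mxdot a b| <= (m * n)%:R * (`|a| * `|b|).
Proof.
rewrite mxdotE (le_trans (ler_norm_sum _ _ _))//.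
have -> : (m * n)%:R * (`|a| * `|b|) = \sum_(i < m) \sum_(j < n) (`|a| * `|b|).
  by rewrite (eq_bigr _ (fun i _ => sumr_const _ _)) sumr_const !card_ord -mulrnA mulnC mulr_natl.
apply: ler_sum => i _; rewrite (le_trans (ler_norm_sum _ _ _))//.
by apply: ler_sum => j _; rewrite normrM ler_pM// mx_entry_le.
Qed.

(** The Heine-Borel theorem for row vectors, carried over by [vec_mx], which preserves the sup
    norm. *)
Lemma bounded_closed_compact_mx (A : set 'M[R]_(m, n)) :
  bounded_set A -> closed A -> compact A.
Proof.
move=> bA cA.
have vc : continuous (vec_mx : 'rV[R]_(m * n) -> 'M[R]_(m, n)).
  move=> v; apply/(@cvgrPdist_le _ _ _ (nbhs (v : 'rV[R]_(m * n)))) => e e0.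
  apply/(@nbhs_normP R 'rV[R]_(m * n)); exists e => //= w /ltW vw.
  apply: mx_norm_le; first exact: ltW.
  move=> i j; rewrite !mxE; apply: le_trans (_ : `|v - w| <= e).
    rewrite [leRHS]/Num.norm /= mx_normrE.
    apply: le_trans (le_bigmax _ (fun ij : 'I_1 * 'I_(m * n) => `|(v - w) ij.1 ij.2|) (ord0, mxvec_index i j)).
    by rewrite /= !mxE.
  by [].
have -> : A = vec_mx @` (vec_mx @^-1` A).
  apply/seteqP; split=> [a Aa|_ [v Av <-]//].
  by exists (mxvec a); rewrite /= mxvecK.
apply: continuous_compact; first exact: continuous_subspaceT.
apply: bounded_closed_compact; last first.
  by apply: closed_comp => // v _; exact: vc.
have [M [Mr MA]] := bA; exists M; split=> // x Mx v /= /(MA _ Mx) vx.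
apply: le_trans vx.
rewrite [leLHS]/Num.norm /= mx_normrE; apply/bigmax_leP; split=> // -[i j] _ /=.
rewrite ord1; case/mxvec_indexP: j => i' j'.
by rewrite -(vec_mxK v) mxvecE vec_mxK mx_entry_le.
Qed.

End MatrixDot.

(** * Strict differentiability *)

Section StrictDifferentiability.
Context {R : realType} {m n : nat}.
Local Notation E := 'M[R]_(m, n).
Implicit Types (f g : E -> R) (p : E) (G : E).

Lemma near_mx_lt p e : 0 < e -> \forall q \near p, `|q - p| < e.
Proof.
move=> e0; apply/(@nbhs_normP R E); exists e => //= q.
by rewrite /= distrC.
Qed.

(** Strict differentiability at [p] with gradient [G]: both points of the difference move. Applied
    to the entries of a gradient, it makes the gradient minus its linear part a map with arbitrarily
    small Lipschitz constant near [p]. *)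
Definition sdiff f p G := forall e, 0 < e -> \forall z \near (p, p),
  `|f z.2 - f z.1 - mxdot G (z.2 - z.1)| <= e * `|z.2 - z.1|.

Lemma sdiff_continuous f p G : sdiff f p G -> {for p, continuous f}.
Proof.
move=> fG; apply/(@cvgrPdist_le _ _ _ (nbhs (p : E))) => e e0.
have K0 : 0 < 1 + (m * n)%:R * `|G| :> R by rewrite ltr_pwDl// mulr_ge0.
have : \forall b \near p, `|f b - f p - mxdot G (b - p)| <= 1 * `|b - p|.
  have [[A B] /= [Ap Bp] AB] := fG 1 ltr01.
  near=> b; apply: (AB (p, b)); split=> /=; first exact: nbhs_singleton.
  by near: b.
move=> fb; near=> b.
have h1 : `|f b - f p - mxdot G (b - p)| <= 1 * `|b - p| by near: b.
have h2 : `|b - p| <= e / (1 + (m * n)%:R * `|G|).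
  by apply: ltW; near: b; apply: near_mx_lt; rewrite divr_gt0.
have h3 := mxdot_le G (b - p).
move: h2; rewrite ler_pdivlMr// => h2.
have := ler_normD (f b - f p - mxdot G (b - p)) (mxdot G (b - p)).
by rewrite subrK distrC; lra.
Unshelve. all: by end_near. Qed.

Lemma sdiff_ext f g p G : f =1 g -> sdiff f p G -> sdiff g p G.
Proof. by move=> /funext ->. Qed.

Lemma sdiff_cst c p : sdiff (fun=> c) p 0.
Proof.
move=> e e0; near=> z.
by rewrite mxdot0l subr0 subrr normr0 mulr_ge0// ltW.
Unshelve. all: by end_near. Qed.

Lemma sdiff_coord i j p : sdiff (fun q => q i j) p (delta_mx i j).
Proof.
move=> e e0; near=> z.
by rewrite mxdot_delta !mxE subrr normr0 mulr_ge0// ltW.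
Unshelve. all: by end_near. Qed.

Lemma sdiffD f g p G H :
  sdiff f p G -> sdiff g p H -> sdiff (fun q => f q + g q) p (G + H).
Proof.
move=> fG gH e e0; have e20 : 0 < e / 2 by rewrite divr_gt0.
near=> z.
have h1 : `|f z.2 - f z.1 - mxdot G (z.2 - z.1)| <= e / 2 * `|z.2 - z.1|.
  by near: z; exact: fG.
have h2 : `|g z.2 - g z.1 - mxdot H (z.2 - z.1)| <= e / 2 * `|z.2 - z.1|.
  by near: z; exact: gH.
rewrite mxdotDl.
have := ler_normD (f z.2 - f z.1 - mxdot G (z.2 - z.1)) (g z.2 - g z.1 - mxdot H (z.2 - z.1)).
have -> : f z.2 - f z.1 - mxdot G (z.2 - z.1) + (g z.2 - g z.1 - mxdot H (z.2 - z.1)) =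
  f z.2 + g z.2 - (f z.1 + g z.1) - (mxdot G (z.2 - z.1) + mxdot H (z.2 - z.1)) by ring.
by move=> /le_trans; apply; rewrite (splitr e) mulrDl lerD.
Unshelve. all: by end_near. Qed.

Lemma sdiffZ k f p G : sdiff f p G -> sdiff (fun q => k * f q) p (k *: G).
Proof.
move=> fG e e0; have k0 : 0 < 1 + `|k| by rewrite ltr_pwDl.
have ek : 0 < e / (1 + `|k|) by rewrite divr_gt0.
near=> z.
have h1 : `|f z.2 - f z.1 - mxdot G (z.2 - z.1)| <= e / (1 + `|k|) * `|z.2 - z.1|.
  by near: z; exact: fG.
rewrite mxdotZl -!mulrBr normrM (le_trans (ler_wpM2l _ h1))//.
rewrite mulrA ler_wpM2r// mulrCA ger_pMr// ler_pdivrMr//; lra.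
Unshelve. all: by end_near. Qed.

Lemma sdiff_sum (I : Type) (r : seq I) (P : pred I) (F : I -> E -> R)
    (G : I -> E) p : (forall i, P i -> sdiff (F i) p (G i)) ->
  sdiff (fun q => \sum_(i <- r | P i) F i q) p (\sum_(i <- r | P i) G i).
Proof.
move=> FG; elim: r => [|i r IH].
  by rewrite big_nil; apply: sdiff_ext (sdiff_cst 0 p) => q; rewrite big_nil.
rewrite big_cons; case: ifP => Pi.
  by apply: sdiff_ext (sdiffD (FG i Pi) IH) => q; rewrite big_cons Pi.
by apply: sdiff_ext IH => q; rewrite big_cons Pi.
Qed.

(* Composition with a function whose difference quotient [h] is continuous
   on the diagonal, which spares any one-variable calculus. *)
Lemma sdiff_comp (phi : R -> R) (h : R * R -> R) f p G :
  (\forall z \near (f p, f p), phi z.2 - phi z.1 = h z * (z.2 - z.1)) ->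
  h @ nbhs (f p, f p) --> h (f p, f p) ->
  sdiff f p G -> sdiff (fun q => phi (f q)) p (h (f p, f p) *: G).
Proof.
move=> phih hc fG e e0; set k := h _.
have fc := sdiff_continuous fG.
pose C := (m * n)%:R * `|G|; have C0 : 0 <= C by rewrite mulr_ge0.
have k0 : 0 < 2 * (1 + `|k|) by rewrite mulr_gt0// ltr_pwDl.
have C20 : 0 < 2 * (1 + C) by rewrite mulr_gt0// ltr_pwDl.
pose e1 := Num.min 1 (e / (2 * (1 + `|k|))).
have e10 : 0 < e1 by rewrite lt_min ltr01 divr_gt0.
pose e2 := e / (2 * (1 + C)); have e20 : 0 < e2 by rewrite divr_gt0.
have hnear : \forall z \near (f p, f p), `|k - h z| <= e2.
  by have /cvgrPdist_le/(_ _ e20) := hc.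
have pull (Q : R * R -> Prop) : (\forall z \near (f p, f p), Q z) ->
    \forall z \near (p, p), Q (f z.1, f z.2).
  move=> [[A B] /= [Ap Bp] sub].
  exists (f @^-1` A, f @^-1` B) => /=; first by split; exact: fc.
  by move=> [a b] /= ab; exact: (sub (f a, f b)).
have pn1 := pull (fun yz => phi yz.2 - phi yz.1 = h yz * (yz.2 - yz.1)) phih.
have pn2 := pull (fun yz => `|k - h yz| <= e2) hnear.
near=> z.
have h1 : `|f z.2 - f z.1 - mxdot G (z.2 - z.1)| <= e1 * `|z.2 - z.1|.
  by near: z; exact: fG.
have h2 : phi (f z.2) - phi (f z.1) = h (f z.1, f z.2) * (f z.2 - f z.1).
  by near: z; exact: pn1.
have h3 : `|k - h (f z.1, f z.2)| <= e2 by near: z; exact: pn2.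
have h4 : `|mxdot G (z.2 - z.1)| <= C * `|z.2 - z.1| by rewrite -mulrA mxdot_le.
have e11 : e1 <= 1 by rewrite ge_min lexx.
have h5 : `|f z.2 - f z.1| <= (1 + C) * `|z.2 - z.1|.
  rewrite -(subrK (mxdot G (z.2 - z.1)) (f z.2 - f z.1)) (le_trans (ler_normD _ _))//.
  have := ler_wpM2r (normr_ge0 (z.2 - z.1)) e11; lra.
rewrite h2 mxdotZl.
have -> : h (f z.1, f z.2) * (f z.2 - f z.1) - k * mxdot G (z.2 - z.1) =
   k * (f z.2 - f z.1 - mxdot G (z.2 - z.1)) - (k - h (f z.1, f z.2)) * (f z.2 - f z.1) by ring.
rewrite (le_trans (ler_normB _ _))// !normrM.
have i1 : `|k| * `|f z.2 - f z.1 - mxdot G (z.2 - z.1)| <= e / 2 * `|z.2 - z.1|.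
  rewrite (le_trans (ler_wpM2l _ h1))// mulrA ler_wpM2r//.
  have : e1 <= e / (2 * (1 + `|k|)) by rewrite ge_min lexx orbT.
  rewrite ler_pdivlMr// => h6; have := normr_ge0 k; nra.
have i2 : `|k - h (f z.1, f z.2)| * `|f z.2 - f z.1| <= e / 2 * `|z.2 - z.1|.
  apply: le_trans (ler_pM _ _ h3 h5) _ => //.
  have -> : e / 2 = e2 * (1 + C) by rewrite /e2; field; rewrite gt_eqF// ltr_pwDl.
  by rewrite mulrA.
have -> : e * `|z.2 - z.1| = e / 2 * `|z.2 - z.1| + e / 2 * `|z.2 - z.1| by field.
exact: lerD.
Unshelve. all: by end_near. Qed.

Lemma sdiff_sqr f p G :
  sdiff f p G -> sdiff (fun q => f q ^+ 2) p ((2 * f p) *: G).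
Proof.
move=> fG; pose h (yz : R * R) := yz.1 + yz.2.
have -> : 2 * f p = h (f p, f p) by rewrite /h /=; ring.
apply: (@sdiff_comp (fun x => x ^+ 2) h _ _ _ _ _ fG).
  by near=> z; rewrite /h; ring.
by apply: cvgD; [exact: cvg_fst|exact: cvg_snd].
Unshelve. all: by end_near. Qed.

Lemma sdiff_cube f p G :
  sdiff f p G -> sdiff (fun q => f q ^+ 3) p ((3 * f p ^+ 2) *: G).
Proof.
move=> fG; pose h (yz : R * R) := yz.1 * yz.1 + yz.1 * yz.2 + yz.2 * yz.2.
have -> : 3 * f p ^+ 2 = h (f p, f p) by rewrite /h /=; ring.
apply: (@sdiff_comp (fun x => x ^+ 3) h _ _ _ _ _ fG).
  by near=> z; rewrite /h; ring.
have c1 : (fun yz : R * R => yz.1) @ nbhs (f p, f p) --> f p by exact: cvg_fst.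
have c2 : (fun yz : R * R => yz.2) @ nbhs (f p, f p) --> f p by exact: cvg_snd.
by apply: cvgD; [apply: cvgD|]; apply: cvgM.
Unshelve. all: by end_near. Qed.

Lemma sdiff_invsqrt f p G : 0 < f p -> sdiff f p G ->
  sdiff (fun q => (Num.sqrt (f q))^-1) p
        ((- (2 * Num.sqrt (f p) ^+ 3)^-1) *: G).
Proof.
move=> f0 fG.
(* The difference quotient of the inverse square root, rationalized so that it is continuous at the
   diagonal point [(f p, f p)]. *)
pose h (yz : R * R) := - ((Num.sqrt yz.1 + Num.sqrt yz.2) * (Num.sqrt yz.1 * Num.sqrt yz.2))^-1.
have -> : - (2 * Num.sqrt (f p) ^+ 3)^-1 = h (f p, f p).
  by rewrite /h /=; congr (- _^-1); ring.
have s0 : 0 < Num.sqrt (f p) by rewrite sqrtr_gt0.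
apply: (@sdiff_comp (fun x => (Num.sqrt x)^-1) h _ _ _ _ _ fG).
  have : \forall z \near (f p, f p), 0 < z.1 /\ 0 < z.2.
    exists ([set x | 0 < x], [set x | 0 < x]); last by move=> z [].
    by split; exact: lt_nbhsr.
  apply: filterS => -[y z] /= [y0 z0].
  have sy : 0 < Num.sqrt y by rewrite sqrtr_gt0.
  have sz : 0 < Num.sqrt z by rewrite sqrtr_gt0.
  rewrite /h /= -[X in _ * (X - _)](sqr_sqrtr (ltW z0)).
  rewrite -[X in _ * (_ - X)](sqr_sqrtr (ltW y0)).
  by field; rewrite !gt_eqF// addr_gt0.
have c1 : (fun yz : R * R => Num.sqrt yz.1) @ nbhs (f p, f p) --> Num.sqrt (f p).
  by apply: continuous_cvg; [exact: sqrt_continuous|exact: cvg_fst].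
have c2 : (fun yz : R * R => Num.sqrt yz.2) @ nbhs (f p, f p) --> Num.sqrt (f p).
  by apply: continuous_cvg; [exact: sqrt_continuous|exact: cvg_snd].
apply: cvgN; apply: cvgV => /=.
  by rewrite gt_eqF// mulr_gt0 ?addr_gt0 ?mulr_gt0.
by apply: cvgM; [apply: cvgD|apply: cvgM].
Unshelve. all: by end_near. Qed.

(** By polarization, [f g] is a quarter of [(f + g) ^ 2 - (f - g) ^ 2], so products reduce to
    squares and linear combinations. *)
Lemma sdiffM f g p G H : sdiff f p G -> sdiff g p H ->
  sdiff (fun q => f q * g q) p (f p *: H + g p *: G).
Proof.
move=> fG gH.
have fg := sdiff_sqr (sdiffD fG gH).
have fg' := sdiff_sqr (sdiffD fG (sdiffZ (-1) gH)).
have := sdiffZ 4^-1 (sdiffD fg (sdiffZ (-1) fg')).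
set K := 4^-1 *: _; have -> : K = f p *: H + g p *: G.
  by apply/matrixP => i j; rewrite !mxE; field.
by apply: sdiff_ext => q; field.
Qed.

Lemma sdiff_line f a v G t : sdiff f (a + t *: v) G ->
  is_derive t (1 : R) (fun t => f (a + t *: v)) (mxdot G v).
Proof.
move=> fG; set w := a + t *: v.
have cv : (fun h : R => h^-1 *: (f (a + (h *: 1 + t) *: v) - f w)) @ 0^' --> mxdot G v.
  apply/cvgrPdist_le => e e0.
  have v0 : 0 < 1 + `|v| by rewrite ltr_pwDl.
  have ev0 : 0 < e / (1 + `|v|) by rewrite divr_gt0.
  have [[A B] /= [Aw Bw] AB] := fG _ ev0.
  have near_w : \forall h \near 0^', B (w + h *: v).
    move: Bw => /nbhs_normP[d /= d0 dB].
    have dv : 0 < d / (1 + `|v|) by rewrite divr_gt0.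
    near=> h; apply: dB => /=.
    rewrite opprD addrA subrr add0r normrN normrZ.
    have : `|h| < d / (1 + `|v|).
      near: h; apply/nbhs_normP; exists (d / (1 + `|v|)) => //= h /=.
      by rewrite sub0r normrN.
    rewrite ltr_pdivlMr//; have := normr_ge0 h; nra.
  near=> h.
  have h0 : h != 0 by near: h; exact: nbhs_dnbhs_neq.
  have := AB (w, w + h *: v); rewrite /=.
  have -> : a + (h *: 1 + t) *: v = w + h *: v.
    by rewrite [h *: 1]mulr1 scalerDl addrA addrAC.
  have -> : w + h *: v - w = h *: v by rewrite addrC addKr.
  rewrite mxdotZr normrZ => le.
  have {}le : `|f (w + h *: v) - f w - h * mxdot G v| <= e / (1 + `|v|) * (`|h| * `|v|).
    by apply: le; split; [exact: nbhs_singleton|near: h].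
  rewrite -(ler_pM2l (_ : 0 < `|h|)) ?normr_gt0// distrC -normrM.
  have -> : h * (h^-1 *: (f (w + h *: v) - f w) - mxdot G v) =
     f (w + h *: v) - f w - h * mxdot G v.
    by rewrite mulrBr; congr (_ - _); rewrite /GRing.scale /= mulrA divff// mul1r.
  apply: le_trans le _; rewrite mulrCA ler_wpM2l// mulrAC ler_pdivrMr//.
  nra.
split; first by apply/cvg_ex; exists (mxdot G v); exact: cv.
by rewrite /derive; apply: cvg_lim.
Unshelve. all: by end_near. Qed.

Lemma sdiff_derive f p G v : sdiff f p G -> 'D_v f p = mxdot G v.
Proof.
move=> fG; have : sdiff f (p + 0 *: v) G by rewrite scale0r addr0.
move=> /sdiff_line [_]; rewrite /derive => <-.
do 2 f_equal; apply/funext => h /=.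
by rewrite scale0r !addr0 [h *: 1]mulr1 [p + _]addrC.
Qed.

Lemma sdiff_MVT f (a b : E) (G : E -> E) :
  (forall t : R, 0 <= t <= 1 -> sdiff f (a + t *: (b - a)) (G (a + t *: (b - a)))) ->
  exists2 t : R, 0 <= t <= 1 & f b - f a = mxdot (G (a + t *: (b - a))) (b - a).
Proof.
move=> fG; pose g t := f (a + t *: (b - a)).
have dg (t : R) : t \in `[0, 1]%R -> is_derive t (1 : R) g (mxdot (G (a + t *: (b - a))) (b - a)).
  by rewrite in_itv /= => t01; apply: sdiff_line; exact: fG.
have cg : {within `[0, 1], continuous g}.
  apply: continuous_in_subspaceT => t; rewrite inE => t01.
  by apply: differentiable_continuous; apply/derivable1_diffP; case: (dg t t01).
have dg' (t : R) : t \in `]0, 1[%R -> is_derive t (1 : R) g (mxdot (G (a + t *: (b - a))) (b - a)).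
  by move=> t01; apply: dg; exact: subset_itv_oo_cc.
have [c c01] := MVT ltr01 dg' cg.
rewrite {cg dg dg'}/g scale1r scale0r addr0 subr0 mulr1 [a + _]addrC subrK => e.
by exists c => //; have := subset_itv_oo_cc c01; rewrite in_itv.
Qed.

End StrictDifferentiability.

(** * The gradient of the potential *)

Lemma sum_offdiag {n : nat} {V : nmodType} (F : 'I_n -> 'I_n -> V) :
  \sum_(i < n) \sum_(j < n | j != i) F i j = \sum_(i < n) \sum_(j < n | (i < j)%N) (F i j + F j i).
Proof.
rewrite (eq_bigr (fun i : 'I_n => \sum_(j < n | (i < j)%N) F i j + \sum_(j < n | (j < i)%N) F i j)); last first.
  move=> i _; rewrite (bigID (fun j : 'I_n => (i < j)%N)) /=.
  congr (_ + _); apply: eq_bigl => j; rewrite -(inj_eq val_inj) /=; case: ltngtP => //.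
rewrite big_split /= [X in _ + X](exchange_big_dep predT) //= -big_split /=.
by apply: eq_bigr => i _; rewrite big_split.
Qed.

(** * Operators acting separately on the x- and the y-coordinates *)

Section PlanarBlocks.
Context {R : realType} {n : nat}.
Implicit Types (A C : 'M[R]_n) (p q : 'M[R]_(n, 2)).

(** The block operator with [A] acting on the x-coordinates and [C] on the y-coordinates: right
    multiplication by a diagonal [delta_mx] keeps one column. Hessian, projection, pseudoinverse and
    mass form all have this shape, so their identities reduce to identities between n x n
    matrices. *)
Definition xyblock A C p : 'M[R]_(n, 2) :=
  A *m p *m (delta_mx 0 0 : 'M[R]_2) + C *m p *m (delta_mx 1 1 : 'M[R]_2).

Lemma mulmx_delta00 p i : (p *m (delta_mx 0 0 : 'M[R]_2)) i 0 = p i 0 /\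
  (p *m (delta_mx 0 0 : 'M[R]_2)) i 1 = 0.
Proof. by split; rewrite mxE big_ord_recl big_ord1 !mxE /= !(mulr0, mulr1, addr0). Qed.

Lemma mulmx_delta11 p i : (p *m (delta_mx 1 1 : 'M[R]_2)) i 0 = 0 /\
  (p *m (delta_mx 1 1 : 'M[R]_2)) i 1 = p i 1.
Proof.
split; rewrite mxE big_ord_recl big_ord1 !mxE /= !(mulr0, mulr1, addr0, add0r)//.
by congr (p i _); apply: val_inj.
Qed.

Lemma xyblock0 A C p i : xyblock A C p i 0 = (A *m p) i 0.
Proof. by rewrite mxE (mulmx_delta00 _ i).1 (mulmx_delta11 _ i).1 addr0. Qed.

Lemma xyblock1 A C p i : xyblock A C p i 1 = (C *m p) i 1.
Proof. by rewrite mxE (mulmx_delta00 _ i).2 (mulmx_delta11 _ i).2 add0r. Qed.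

Lemma matrix2P p q : (forall i, p i 0 = q i 0) -> (forall i, p i 1 = q i 1) -> p = q.
Proof.
move=> pq0 pq1; apply/matrixP => i j.
have [->|j1] := eqVneq j 0; first exact: pq0.
suff -> : j = 1 by exact: pq1.
by apply: val_inj; case: j j1 => -[|[|]].
Qed.

Lemma xyblockD A C p q : xyblock A C (p + q) = xyblock A C p + xyblock A C q.
Proof. by rewrite /xyblock !mulmxDr !mulmxDl addrACA. Qed.

Lemma xyblockZ A C k p : xyblock A C (k *: p) = k *: xyblock A C p.
Proof. by rewrite /xyblock -!scalemxAr -!scalemxAl scalerDr. Qed.

Lemma xyblock_comp A C A' C' p :
  xyblock A C (xyblock A' C' p) = xyblock (A *m A') (C *m C') p.
Proof.
have col k (M : 'M[R]_n) (u v : 'M[R]_(n, 2)) : (forall i, u i k = v i k) ->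
    forall i, (M *m u) i k = (M *m v) i k.
  by move=> uv i; rewrite !mxE; apply: eq_bigr => j _; rewrite uv.
apply: matrix2P => i.
  rewrite !xyblock0 -mulmxA; apply: col => j; exact: xyblock0.
rewrite !xyblock1 -mulmxA; apply: col => j; exact: xyblock1.
Qed.

Lemma xyblock_dot A C p q :
  mxdot (xyblock A C p) q = mxdot p (xyblock A^T C^T q).
Proof.
rewrite /mxdot /xyblock linearD /= !trmx_mul !trmx_delta mulmxDl mulmxDr !mxtraceD.
by congr (_ + _); rewrite -!mulmxA mxtrace_mulC !mulmxA.
Qed.

End PlanarBlocks.

Section PotentialGradient.
Context {R : realType} {n : nat}.
Variable m : 'I_n -> R.
Local Notation E := 'M[R]_(n, 2).
Implicit Types q v : E.

Lemma distC q i j : dist q i j = dist q j i.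
Proof. by rewrite /dist; congr (Num.sqrt _); ring. Qed.

Lemma dist_gt0 q i j : collision_free q -> i != j -> 0 < dist q i j.
Proof.
move=> cf ij; rewrite sqrtr_gt0 lt_def addr_ge0 ?sqr_ge0// andbT.
apply: contraNneq (cf i j ij) => /eqP.
rewrite paddr_eq0 ?sqr_ge0// !sqrf_eq0 !subr_eq0 => /andP[/eqP h0 /eqP h1].
apply/eqP/matrixP => k l; rewrite !mxE.
have [->//|l1] := eqVneq l 0.
suff -> : l = 1 by [].
by apply: val_inj; case: l l1 => -[|[|]].
Qed.

Definition pair_dir i j (k : 'I_2) : E := delta_mx i k - delta_mx j k.

Lemma pair_dirE i j k v : mxdot (pair_dir i j k) v = v i k - v j k.
Proof. by rewrite mxdotBl !mxdot_delta. Qed.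

Lemma sdiff_diff i j k q :
  sdiff (fun q => q i k - q j k) q (pair_dir i j k).
Proof.
have := sdiffD (sdiff_coord i k q) (sdiffZ (-1) (sdiff_coord j k q)).
by rewrite scaleN1r; apply: sdiff_ext => p; rewrite mulN1r.
Qed.

Definition invdist_grad q i j : E := - (dist q i j)^-1 ^+ 3 *:
  ((q i 0 - q j 0) *: pair_dir i j 0 + (q i 1 - q j 1) *: pair_dir i j 1).

Lemma sdiff_invdist q i j : collision_free q -> i != j ->
  sdiff (fun q => (dist q i j)^-1) q (invdist_grad q i j).
Proof.
move=> cf ij; have d0 := dist_gt0 cf ij.
have := sdiffD (sdiff_sqr (sdiff_diff i j 0 q)) (sdiff_sqr (sdiff_diff i j 1 q)).
have p0 : 0 < (q i 0 - q j 0) ^+ 2 + (q i 1 - q j 1) ^+ 2.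
  by move: d0; rewrite sqrtr_gt0.
move=> /(sdiff_invsqrt p0); set G := (X in sdiff _ _ X).
suff -> : G = invdist_grad q i j by apply: sdiff_ext.
rewrite /G /invdist_grad -/(dist q i j); apply/matrixP => a b; rewrite !mxE.
by field; rewrite gt_eqF.
Qed.

Definition gradU q : E := \matrix_(i, k)
  \sum_(j | j != i) m i * m j * (- (dist q i j)^-1 ^+ 3 * (q i k - q j k)).

Lemma gradUE q : gradU q =
  \sum_(i < n) \sum_(j < n | (i < j)%N) (m i * m j) *: invdist_grad q i j.
Proof.
pose c i j := m i * m j * - (dist q i j)^-1 ^+ 3.
(* [F i j] is what mass [j] contributes to row [i]; [F i j + F j i] is the gradient of the single
   term of the potential that belongs to the pair. *)
pose F i j := \sum_k (c i j * (q i k - q j k)) *: (delta_mx i k : E).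
transitivity (\sum_(i < n) \sum_(j < n | j != i) F i j); last first.
  rewrite sum_offdiag; apply: eq_bigr => i _; apply: eq_bigr => j _.
  rewrite /F /invdist_grad !big_ord_recl !big_ord0 !addr0 /c distC (mulrC (m j)).
  rewrite (_ : lift _ _ = 1); last exact: val_inj.
  by apply/matrixP => a b; rewrite /pair_dir !mxE (distC q j i); ring.
apply/matrixP => a k; rewrite mxE summxE [RHS](bigD1 a) //= [X in _ + X]big1 ?addr0; last first.
  move=> i ia; rewrite summxE big1 // => j _; rewrite summxE big1 // => l _.
  by rewrite !mxE eq_sym (negPf ia) /= mulr0.
rewrite summxE; apply: eq_bigr => j _; rewrite summxE (bigD1 k) //= big1 ?addr0.
  by rewrite !mxE !eqxx mulr1 /c !mulrA.
by move=> l /negPf lk; rewrite !mxE [k == l]eq_sym lk andbF mulr0.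
Qed.

Lemma sdiff_potential q : collision_free q -> sdiff (potential m) q (gradU q).
Proof.
move=> cf; rewrite gradUE; apply: sdiff_sum => i _; apply: sdiff_sum => j ij.
by apply: sdiffZ; apply: sdiff_invdist => //; rewrite neq_ltn ij.
Qed.

Lemma derive_potential q v : collision_free q ->
  'D_v (potential m) q = mxdot (gradU q) v.
Proof. by move=> cf; apply/sdiff_derive/sdiff_potential. Qed.

Lemma gradU_dot q v : mxdot (gradU q) v =
  \sum_(i < n) \sum_(j < n | (i < j)%N) m i * m j * (- (dist q i j)^-1 ^+ 3 *
    ((q i 0 - q j 0) * (v i 0 - v j 0) + (q i 1 - q j 1) * (v i 1 - v j 1))).
Proof.
rewrite gradUE mxdot_suml; apply: eq_bigr => i _.
rewrite mxdot_suml; apply: eq_bigr => j _.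
by rewrite mxdotZl mxdotZl mxdotDl !mxdotZl !pair_dirE.
Qed.

Lemma collinear_dist q i j : (forall i, q i 0 = 0) ->
  dist q i j = `|q i 1 - q j 1|.
Proof. by move=> q0; rewrite /dist !q0 subrr expr0n add0r sqrtr_sqr. Qed.

(** The rows of [B_mx] sum to 0, so only differences of entries appear: [B_mx] is minus a weighted
    graph Laplacian. *)
Lemma B_mxE q r (v : 'M[R]_(n, r)) i k : (B_mx m q *m v) i k =
  \sum_(j | j != i) m i * m j / dist q i j ^+ 3 * (v j k - v i k).
Proof.
rewrite mxE (bigD1 i) //= mxE eqxx mulNr mulr_suml -sumrN -big_split /=.
by apply: eq_bigr => j ji; rewrite mxE eq_sym (negPf ji); ring.
Qed.

(** At a point of the y-axis at distance d from 0, the inverse distance to 0 has second derivative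
    [- 1 / d ^ 3] across the axis and [2 / d ^ 3] along it, and no mixed one. These are the weights
    [w], and they produce the blocks [B] and [-2 B]. *)
Lemma sdiff_gradU q : collision_free q -> (forall i, q i 0 = 0) ->
  forall e, 0 < e -> \forall z \near (q, q),
  `|gradU z.2 - gradU z.1 -
    xyblock (B_mx m q) (-2 *: B_mx m q) (z.2 - z.1)| <= e * `|z.2 - z.1|.
Proof.
move=> cf q0 e e0.
pose w (k : 'I_2) : R := if k == 0 then -1 else 2.
have H i k : sdiff (fun q => gradU q i k) q
    (\sum_(j | j != i) (m i * m j) *: (((dist q i j)^-1 ^+ 3 * w k) *: pair_dir i j k)).
  apply: (@sdiff_ext _ _ _ (fun q => \sum_(j | j != i) m i * m j * (- (dist q i j)^-1 ^+ 3 * (q i k - q j k)))).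
    by move=> p; rewrite mxE.
  apply: sdiff_sum => j ji.
  have ij : i != j by rewrite eq_sym.
  have d0 := dist_gt0 cf ij.
  have dd : (q i 1 - q j 1) ^+ 2 = dist q i j ^+ 2.
    by rewrite collinear_dist// real_normK// num_real.
  apply: sdiffZ.
  have := sdiffM (sdiffZ (-1) (sdiff_cube (sdiff_invdist cf ij))) (sdiff_diff i j k q).
  set G := (X in sdiff _ _ X).
  suff -> : G = ((dist q i j)^-1 ^+ 3 * w k) *: pair_dir i j k.
    by apply: sdiff_ext => p; rewrite mulN1r.
  rewrite /G {G} /invdist_grad !q0 subrr scale0r add0r /w.
  have [->|k1] := eqVneq k 0.
    by rewrite !q0 subrr scale0r addr0; congr (_ *: _); ring.
  have -> : k = 1 by apply: val_inj; case: k k1 => -[|[|]].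
  rewrite !scalerA -scalerDl; congr (_ *: _).
  transitivity (- (dist q i j)^-1 ^+ 3 + 3 * (dist q i j)^-1 ^+ 5 * (q i 1 - q j 1) ^+ 2).
    by ring.
  by rewrite dd; field; rewrite gt_eqF.
have HB i k v : mxdot (\sum_(j | j != i) (m i * m j) *: (((dist q i j)^-1 ^+ 3 * w k) *: pair_dir i j k)) v
    = xyblock (B_mx m q) (-2 *: B_mx m q) v i k.
  rewrite mxdot_suml.
  have [->|k1] := eqVneq k 0.
    rewrite xyblock0 B_mxE; apply: eq_bigr => j _.
    by rewrite mxdotZl mxdotZl pair_dirE /w /=  exprVn; ring.
  have {k1}-> : k = 1 by apply: val_inj; case: k k1 => -[|[|]].
  rewrite xyblock1 -scalemxAl mxE B_mxE mulr_sumr; apply: eq_bigr => j _.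
  by rewrite mxdotZl mxdotZl pair_dirE /w /= exprVn; ring.
pose Q (ik : 'I_n * 'I_2) (z : E * E) :=
  `|gradU z.2 ik.1 ik.2 - gradU z.1 ik.1 ik.2 -
      xyblock (B_mx m q) (-2 *: B_mx m q) (z.2 - z.1) ik.1 ik.2| <= e * `|z.2 - z.1|.
have HQ ik : \forall z \near (q, q), Q ik z.
  by case: ik => i k; near=> z; rewrite /Q /= -HB; near: z; exact: H.
have : \forall z \near (q, q), forall ik, Q ik z by exact: (@filter_forall _ _ Q _ _ HQ).
apply: filterS => z Hz; apply: mx_norm_le; first by rewrite mulr_ge0// ltW.
move=> i k; have e1 (A B C : E) : (A - B - C) i k = A i k - B i k - C i k.
  by rewrite !mxE.
by rewrite e1; exact: (Hz (i, k)).
Unshelve. all: by end_near. Qed.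

End PotentialGradient.

(** * Lyapunov-Schmidt reduction *)

Section MatrixMaps.
Context {R : realType} {m n : nat}.
Local Notation E := 'M[R]_(m, n).

Lemma linear_mx_bounded (L : {linear E -> E}) :
  exists2 C : R, 0 < C & forall x, `|L x| <= C * `|x|.
Proof.
exists (1 + \sum_i \sum_j `|L (delta_mx i j)|) => [|x].
  by rewrite ltr_pwDl// sumr_ge0// => i _; rewrite sumr_ge0.
rewrite mulrDl mul1r mulr_suml {1}[x]matrix_sum_delta linear_sum ler_wpDl//.
rewrite (le_trans (ler_norm_sum _ _ _))//; apply: ler_sum => i _.
rewrite linear_sum mulr_suml (le_trans (ler_norm_sum _ _ _))//.
by apply: ler_sum => j _; rewrite linearZ normrZ mulrC ler_wpM2l// mx_entry_le.
Qed.

Lemma lipschitz_continuous_within (D : set E) (f : E -> R) (K : R) :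
  0 <= K ->
  (forall a b, D a -> D b -> `|f b - f a| <= K * `|b - a|) ->
  {within D, continuous f}.
Proof.
move=> K0 fK; apply/subspace_continuousP => x Dx.
apply/(@cvgrPdist_le _ _ _ (within D (nbhs (x : E)))) => e e0.
have K1 : 0 < 1 + K by rewrite ltr_pwDl.
have eK : 0 < e / (1 + K) by rewrite divr_gt0.
have := near_mx_lt x eK; rewrite near_withinE; apply: filterS => y yx Dy.
rewrite distrC (le_trans (fK _ _ Dx Dy))//.
move: yx; rewrite ltr_pdivlMr// => yx.
have := normr_ge0 (y - x); lra.
Qed.

Lemma closed_mx_ball (r : R) : closed [set a : E | `|a| <= r].
Proof.
apply: (@closed_comp E R Num.norm [set x | x <= r]); last exact: closed_le.
by move=> x _; exact: norm_continuous.
Qed.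

Lemma bounded_mx_ball (r : R) : bounded_set [set a : E | `|a| <= r].
Proof.
by exists r; split=> [|x rx v /= vr]; rewrite ?num_real// (le_trans vr)// ltW.
Qed.

(* A minimizer of the displacement [`|a - F a|] must be a fixed point. *)
Lemma ball_fixed_point (F : E -> E) (r : R) : 0 <= r ->
  (forall a, `|a| <= r -> `|F a| <= r) ->
  (forall a b, `|a| <= r -> `|b| <= r -> `|F b - F a| <= 2^-1 * `|b - a|) ->
  exists2 p, `|p| <= r & p = F p.
Proof.
move=> r0 Fr Fc; pose U := [set a : E | `|a| <= r].
have U0 : U !=set0 by exists 0; rewrite /U /= normr0.
have cU : compact U.
  by apply: bounded_closed_compact_mx; [exact: bounded_mx_ball|exact: closed_mx_ball].
have cf : {within U, continuous (fun a => `|a - F a|)}.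
  apply: (@lipschitz_continuous_within _ _ 2) => // a b Ua Ub.
  apply: le_trans (ler_dist_dist _ _) _.
  have -> : b - F b - (a - F a) = b - a - (F b - F a).
    by apply/matrixP => i j; rewrite !mxE; ring.
  by rewrite (le_trans (ler_normB _ _))//; have := Fc _ _ Ua Ub; have := normr_ge0 (b - a); lra.
have [p] := compact_EVT_min U0 cU cf; rewrite inE => Up pmin; exists p => //.
apply/eqP; rewrite -subr_eq0 -normr_eq0.
have UF : U (F p) by exact: Fr.
have := pmin (F p); rewrite inE => /(_ UF).
have := Fc _ _ UF Up; have := normr_ge0 (p - F p).
by rewrite -(distrC (F p)) (distrC (F p)) eq_le; lra.
Qed.

Lemma linear_mx_continuous (L : {linear E -> E}) : continuous L.
Proof.
have [C C0 LC] := linear_mx_bounded L.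
move=> x; apply/(@cvgrPdist_le _ _ _ (nbhs (x : E))) => e e0.
have := near_mx_lt x (divr_gt0 e0 C0); apply: filterS => y yx.
rewrite distrC -linearB (le_trans (LC _))//.
by move: yx; rewrite ltr_pdivlMr// mulrC => /ltW.
Qed.

End MatrixMaps.

Section LyapunovSchmidt.
Context {R : realType} {m n : nat}.
Local Notation E := 'M[R]_(m, n).
Variables H T P : {linear E -> E}.
Hypothesis HT : forall x, H (T x) = x - P x.
Hypothesis PT : forall x, P (T x) = 0.
Hypothesis PH : forall x, P (H x) = 0.
Hypothesis HP : forall x, H (P x) = 0.
Hypothesis Psym : forall a b, mxdot (P a) b = mxdot a (P b).

Lemma proj_idem x : P (P x) = P x.
Proof. by apply/eqP; rewrite eq_sym -subr_eq0 -linearB -HT PH. Qed.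

(* The solutions of [v = P p] and [(1 - P) (g p) = 0] are the fixed points of
   [p |-> v - T (g p - H p)], which form a Lipschitz graph over [v]; on that
   graph [g p] is orthogonal to everything but the increments of [v]. *)
Lemma reduced_critical_point (Psi : E -> R) (g : E -> E) (C rho : R) :
  0 < rho -> 0 <= C -> g 0 = 0 ->
  (forall a b, `|a| <= 2 * rho -> `|b| <= 2 * rho ->
    `|T (g b - H b - (g a - H a))| <= 2^-1 * `|b - a|) ->
  (forall a b, `|a| <= 2 * rho -> `|b| <= 2 * rho ->
    `|Psi b - Psi a - mxdot (g a) (b - a)| <= C * `|b - a| ^+ 2) ->
  (exists B, forall a, `|a| <= 2 * rho -> `|g a| <= B) ->
  exists p v, [/\ P v = v, `|v| <= rho, `|p| <= 2 * rho,
    p = v - T (g p - H p) &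
    (forall v', P v' = v' -> `|v'| <= rho -> exists p', [/\ `|p'| <= 2 * rho,
        p' = v' - T (g p' - H p') & Psi p <= Psi p']) /\
    (`|v| < rho -> g p = 0)].
Proof.
move=> rho0 C0 g0 gT taylor [B gB].
(* The bound on [v] stands under the existential, so that [choice] yields one function [pv] on the
   whole space. *)
have fp v : exists p, `|v| <= rho -> `|p| <= 2 * rho /\ p = v - T (g p - H p).
  have [vr|_] := boolP (`|v| <= rho); last by exists 0.
  (* The ball for [p] has twice the radius of the ball for [v]: the image has norm at most [rho]
     from [v] plus half of [2 * rho] from the contraction. *)
  have [|a ar|a b ar br|p pr pE] :=
      @ball_fixed_point R m n (fun p => v - T (g p - H p)) (2 * rho).
  - by rewrite mulr_ge0// ltW.
  - have := gT 0 a; rewrite normr0 mulr_ge0 ?(ltW rho0)// => /(_ isT ar).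
    rewrite g0 linear0 !subr0 => gTa.
    by rewrite (le_trans (ler_normB _ _))//; lra.
  - rewrite opprB addrC addrA subrK -linearB distrC.
    exact: gT.
  by exists p.
have [pv pvP] := choice fp.
have pvP1 v : `|v| <= rho -> `|pv v| <= 2 * rho by case/pvP.
have pvP2 v : `|v| <= rho -> pv v = v - T (g (pv v) - H (pv v)) by case/pvP.
have pvL v w : `|v| <= rho -> `|w| <= rho -> `|pv w - pv v| <= 2 * `|w - v|.
  move=> vr wr; have := gT _ _ (pvP1 _ vr) (pvP1 _ wr).
  set d := T _ => dle.
  have e : pv w - pv v = w - v - d.
    rewrite {1}(pvP2 _ wr) {1}(pvP2 _ vr) /d [T (_ - _ - _)]linearB.
    by apply/matrixP => i j; rewrite !mxE; ring.
  have := ler_normB (w - v) d; rewrite -e; lra.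
pose D := [set v : E | P v = v /\ `|v| <= rho].
have D0 : D !=set0 by exists 0; rewrite /D /= linear0 normr0; split=> //; exact: ltW.
have cD : compact D.
  apply: bounded_closed_compact_mx.
    by exists rho; split=> [|x rx v [_ vr]] /=; rewrite ?num_real// (le_trans vr)// ltW.
  rewrite (_ : D = [set v : E | `|P v - v| <= 0] `&` [set v : E | `|v| <= rho]); last first.
    apply/seteqP; split=> v [/= h1 h2]; split=> //=.
      by rewrite h1 subrr normr0.
    by apply/eqP; rewrite -subr_eq0 -normr_le0.
  apply: closedI.
    apply: (@closed_comp E E (fun v => P v - v) [set a | `|a| <= 0]).
      move=> v _; apply: (@continuousB R E); last exact: cvg_id.
      exact: linear_mx_continuous.
    exact: closed_mx_ball.
  exact: closed_mx_ball.
pose N : R := (m * n)%:R.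
have B0 : 0 <= B.
  by apply: le_trans (gB 0 _); rewrite // normr0 mulr_ge0// ltW.
have N0 : 0 <= N by rewrite /N.
pose K := N * B + C * (4 * rho).
have K0 : 0 <= K by rewrite addr_ge0 ?mulr_ge0// ltW.
have cPsi : {within D, continuous (Psi \o pv)}.
  apply: (@lipschitz_continuous_within _ _ _ _ _ (K * 2)); first by rewrite mulr_ge0.
  move=> v w [_ vr] [_ wr] /=.
  have ar := pvP1 _ vr; have br := pvP1 _ wr; have := pvL _ _ vr wr.
  move: (pv v) (pv w) ar br => a b ar br le.
  rewrite -mulrA (le_trans _ (ler_wpM2l K0 le))//.
  have h1 := taylor _ _ ar br.
  have h2 : `|mxdot (g a) (b - a)| <= N * B * `|b - a|.
    rewrite (le_trans (mxdot_le _ _))// -mulrA ler_wpM2l// ler_wpM2r//.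
    exact: gB.
  have h3 : `|b - a| <= 4 * rho by have := ler_normB b a; lra.
  have h4 : C * `|b - a| ^+ 2 <= C * (4 * rho) * `|b - a|.
    by rewrite -mulrA ler_wpM2l// expr2 ler_wpM2r.
  rewrite -(subrK (mxdot (g a) (b - a)) (Psi b - Psi a)).
  rewrite (le_trans (ler_normD _ _))// /K; lra.
have [v] := compact_EVT_min D0 cD cPsi.
rewrite inE => -[Pv vr] /= vmin.
exists (pv v), v; split=> //; [exact: pvP1|exact: pvP2|split].
  move=> v' Pv' v'r; exists (pv v'); split; [exact: pvP1|exact: pvP2|].
  by apply: vmin; rewrite inE.
move=> vlt.
set p := pv v; set u := g p.
have Ppv w : P w = w -> `|w| <= rho -> P (pv w) = w.
  by move=> Pw wr; rewrite (pvP2 _ wr) linearB /= PT subr0.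
(* Applying [H], which kills [v = P v], to the fixed point equation shows that [H p] cancels the
   part of [g p - H p] outside the kernel, so [g p] is in the range of [P]. *)
have Pu : P u = u.
  have gE : u = P (g p - H p).
    have : H p = - (g p - H p) + P (g p - H p).
      rewrite {1}/p (pvP2 _ vr) linearB /= -{1}Pv HP HT -/p.
      by rewrite sub0r opprB addrC.
    rewrite /u => e; apply: (@addIr _ (- (g p - H p))).
    by rewrite [RHS]addrC -e opprB addrC subrK.
  by rewrite gE proj_idem.
apply: mxdot_eq0; apply/eqP; apply: contraT => unz.
have u2 : 0 < mxdot u u by rewrite lt_def unz mxdot_ge0.
(* If [u] were nonzero, the step from [v] to [v - t u] would gain [t <u, u>] to first order and lose
   at most [C (2 t |u|) ^ 2]. The factor 4 is the square of the Lipschitz constant of [pv]; the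
   added 1 makes the contradiction strict and [X] positive. *)
pose X := 4 * C * `|u| ^+ 2 + 1.
have X0 : 0 < X by rewrite ltr_wpDl// mulr_ge0 ?mulr_ge0 ?sqr_ge0.
have u1 : 0 < 1 + `|u| by rewrite ltr_pwDl.
pose t := Num.min ((rho - `|v|) / (1 + `|u|)) (mxdot u u / (2 * X)).
have t0 : 0 < t by rewrite lt_min !divr_gt0 ?subr_gt0// mulr_gt0.
have t1 : t * `|u| <= rho - `|v|.
  have : t <= (rho - `|v|) / (1 + `|u|) by rewrite ge_min lexx.
  by rewrite ler_pdivlMr//; lra.
have t2 : t * X <= mxdot u u / 2.
  have : t <= mxdot u u / (2 * X) by rewrite ge_min lexx orbT.
  by rewrite ler_pdivlMr ?mulr_gt0//; lra.
pose w := v - t *: u.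
have Pw : P w = w by rewrite linearB linearZ /= Pv Pu.
have wr : `|w| <= rho.
  rewrite (le_trans (ler_normB _ _))// normrZ (gtr0_norm t0); lra.
have := vmin w; rewrite inE => /(_ (conj Pw wr)) /=.
have := taylor _ _ (pvP1 _ vr) (pvP1 _ wr).
have := pvL _ _ vr wr.
(* As [u] is in the range of the symmetric [P], its pairing with [pv w - p] equals its pairing with
   [w - v], whatever the graph does in the complementary directions. *)
rewrite -/p -/u -[X in mxdot X _]Pu Psym linearB /= (Ppv _ Pw wr) (Ppv _ Pv vr).
have -> : w - v = - (t *: u) by rewrite /w addrC addKr.
rewrite normrN normrZ (gtr0_norm t0) mxdotNr mxdotZr => h1.
have h2 : C * `|pv w - p| ^+ 2 <= t * (t * (4 * C * `|u| ^+ 2)).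
  apply: (@le_trans _ _ (C * (2 * (t * `|u|)) ^+ 2)); last by rewrite exprMn exprMn; lra.
  by rewrite ler_wpM2l// lerXn2r// nnegrE ?mulr_ge0// ltW.
rewrite ler_norml => /andP[_ h3] h4.
have h5 : t * (t * X) <= t * (mxdot u u / 2) by rewrite ler_wpM2l// ltW.
have h6 : 0 < t * mxdot u u by rewrite mulr_gt0.
have h7 : 0 < t * t by rewrite mulr_gt0.
have : t * (t * X) = t * (t * (4 * C * `|u| ^+ 2)) + t * t by rewrite /X; ring.
lra.
Qed.

End LyapunovSchmidt.

(** * Critical points with a small multiplier, by penalization *)

Section GradientBifurcation.
Context {R : realType} {m n : nat}.
Local Notation E := 'M[R]_(m, n).
Variables H T P S : {linear E -> E}.
Hypothesis HT : forall x, H (T x) = x - P x.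
Hypothesis PT : forall x, P (T x) = 0.
Hypothesis PH : forall x, P (H x) = 0.
Hypothesis HP : forall x, H (P x) = 0.
Hypothesis Psym : forall a b, mxdot (P a) b = mxdot a (P b).
Hypothesis Hsym : forall a b, mxdot (H a) b = mxdot a (H b).
Hypothesis Ssym : forall a b, mxdot (S a) b = mxdot a (S b).
Variable kappa : R.
Hypothesis kappa_gt0 : 0 < kappa.
Hypothesis Spos : forall v, P v = v -> kappa * `|v| ^+ 2 <= mxdot (S v) v.

Definition sphere_defect x := mxdot (S x) x - 1.
Local Notation sg := sphere_defect.

Lemma mxdot_linear_le (L : {linear E -> E}) : exists2 c : R, 0 <= c &
  forall a b, `|mxdot (L a) b| <= c * (`|a| * `|b|).
Proof.
have [C C0 LC] := linear_mx_bounded L.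
exists ((m * n)%:R * C) => [|a b]; first by rewrite mulr_ge0// ltW.
by rewrite (le_trans (mxdot_le _ _))// -mulrA ler_wpM2l// mulrA ler_wpM2r.
Qed.

Lemma sphere_defectB a b :
  sg b - sg a = mxdot (S (b - a)) b + mxdot (S (b - a)) a.
Proof.
by rewrite /sg [S (b - a)]linearB /= !mxdotBl (Ssym a b) (mxdotC a); ring.
Qed.

Lemma sphere_defect_lipschitz (r : R) : 0 <= r -> exists2 K, 0 <= K &
  forall a b, `|a| <= r -> `|b| <= r -> `|sg b - sg a| <= K * `|b - a|.
Proof.
move=> r0; have [c c0 Sc] := mxdot_linear_le S.
exists (2 * c * r) => [|a b ar br]; first by rewrite !mulr_ge0.
rewrite sphere_defectB (le_trans (ler_normD _ _))//.
have h1 : c * (`|b - a| * `|b|) <= c * (`|b - a| * r) by rewrite !ler_wpM2l.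
have h2 : c * (`|b - a| * `|a|) <= c * (`|b - a| * r) by rewrite !ler_wpM2l.
have := Sc (b - a) b; have := Sc (b - a) a; lra.
Qed.

(** The function [sg x ^+ 2 / 4] has gradient [sg x *: S x]. On a ball this gradient is Lipschitz
    and the Taylor remainder is quadratic, so after multiplication by a small constant the penalty
    does not disturb the contraction. *)
Lemma penalty_bounds (r : R) : 0 <= r -> exists2 K, 0 <= K &
  forall a b, `|a| <= r -> `|b| <= r ->
  `|sg b *: S b - sg a *: S a| <= K * `|b - a| /\
  `|sg b ^+ 2 / 4 - sg a ^+ 2 / 4 - mxdot (sg a *: S a) (b - a)|
    <= K * `|b - a| ^+ 2.
Proof.
move=> r0; have [c c0 Sc] := mxdot_linear_le S.
have [C /ltW C0 SC] := linear_mx_bounded S.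
have [L L0 sgL] := sphere_defect_lipschitz r0.
pose M := c * (r * r) + 1.
have M0 : 0 <= M by rewrite addr_ge0 ?mulr_ge0.
have sgM x : `|x| <= r -> `|sg x| <= M.
  move=> xr; rewrite (le_trans (ler_normB _ _))// normr1 lerD2r.
  by rewrite (le_trans (Sc _ _))// ler_wpM2l// ler_pM.
have X0 : 0 <= L * (C * r) by rewrite !mulr_ge0.
have Y0 : 0 <= M * C by rewrite mulr_ge0.
have Z0 : 0 <= L ^+ 2 by rewrite sqr_ge0.
have W0 : 0 <= M * c by rewrite mulr_ge0.
exists (M * C + L * (C * r) + L ^+ 2 + M * c) => [|a b ar br]; first by lra.
split.
  have -> : sg b *: S b - sg a *: S a = sg b *: S (b - a) + (sg b - sg a) *: S a.
    by rewrite linearB /=; apply/matrixP => i j; rewrite !mxE; ring.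
  have h1 : `|sg b *: S (b - a)| <= M * C * `|b - a|.
    by rewrite normrZ -mulrA ler_pM// sgM.
  have h2 : `|(sg b - sg a) *: S a| <= L * (C * r) * `|b - a|.
    rewrite normrZ [leRHS]mulrAC ler_pM//; first exact: sgL.
    by rewrite (le_trans (SC _))// ler_wpM2l.
  have h3 : 0 <= (L ^+ 2 + M * c) * `|b - a| by rewrite mulr_ge0// addr_ge0.
  rewrite (le_trans (ler_normD _ _))//; lra.
set d := b - a; set tau := sg b - sg a.
have tauE : tau = 2 * mxdot (S a) d + mxdot (S d) d.
  rewrite /tau sphere_defectB -/d -[in X in mxdot _ X + _](subrK a b) -/d.
  by rewrite mxdotDr (Ssym d a) (mxdotC d); ring.
have -> : sg b ^+ 2 / 4 - sg a ^+ 2 / 4 - mxdot (sg a *: S a) d =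
    tau ^+ 2 / 4 + sg a * mxdot (S d) d / 2.
  have -> : sg b = sg a + tau by rewrite /tau; ring.
  by rewrite mxdotZl tauE; field.
have h3 : `|tau ^+ 2 / 4| <= L ^+ 2 * `|d| ^+ 2.
  rewrite normrM normrX -exprMn (ger0_norm (_ : 0 <= 4^-1 :> R))//.
  apply: (@le_trans _ _ (`|tau| ^+ 2)); first by rewrite ler_piMr ?sqr_ge0// invf_le1// ler1n.
  by rewrite lerXn2r ?nnegrE ?mulr_ge0// sgL.
have h4 : `|sg a * mxdot (S d) d / 2| <= M * c * `|d| ^+ 2.
  rewrite normrM (ger0_norm (_ : 0 <= 2^-1 :> R))//.
  apply: (@le_trans _ _ `|sg a * mxdot (S d) d|); first by rewrite ler_piMr// invf_le1// ler1n.
  by rewrite normrM -mulrA ler_pM// ?sgM// expr2.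
have h5 : 0 <= (M * C + L * (C * r)) * `|d| ^+ 2 by rewrite mulr_ge0 ?addr_ge0 ?sqr_ge0.
rewrite (le_trans (ler_normD _ _))//; lra.
Qed.

(** [X] and [Y] stand for the penalized values at the minimizer and at a competitor, [x] and [y] for
    their sphere defects. Minimality gives [c / 4 * x ^+ 2 <= c / 4 * y ^+ 2 + 2 * c ^+ 2 * D]; as
    [y] is [O(c)], [x ^+ 2] is [O(c)] too. *)
Lemma penalty_comparison (c D B x y X Y : R) : 0 < c -> c <= 1 ->
  c * (16 * (2 * D + B ^+ 2)) <= 1 ->
  `|X - c / 4 * x ^+ 2| <= c ^+ 2 * D -> `|Y - c / 4 * y ^+ 2| <= c ^+ 2 * D ->
  `|y| <= c * B -> X <= Y -> `|x| <= 2^-1.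
Proof.
move=> c0 c1 cD; rewrite !ler_norml => /andP[h1 _] /andP[_ h2] /andP[h3 h4] h5.
have k1 : y ^+ 2 <= c ^+ 2 * B ^+ 2 by nra.
have k2 : c * y ^+ 2 <= c ^+ 2 * B ^+ 2 * c by rewrite mulrC ler_wpM2r// ltW.
have cB : 0 <= c ^+ 2 * B ^+ 2 by rewrite mulr_ge0 ?sqr_ge0.
have k3 : c ^+ 2 * B ^+ 2 * c <= c ^+ 2 * B ^+ 2 by rewrite ler_piMr.
have k4 : c * x ^+ 2 <= c * (c * (4 * (2 * D + B ^+ 2))) by lra.
move: k4; rewrite ler_pM2l// => k4.
by rewrite -ler_norml -ler_sqr ?nnegrE// real_normK ?num_real//; lra.
Qed.

(* The penalty [c / 4 * (<S p, p> - 1) ^ 2] replaces the constraint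
   [<S p, p> = 1]: its gradient is [c (<S p, p> - 1) S p], so a critical point
   of the penalized function has a multiplier of size [O(c)], and comparing
   with a unit vector of the kernel of [H] shows that the minimum on the
   reduced graph is interior and away from [0]. *)
Lemma penalized_critical_point (v0 : E) (rho : R) : P v0 = v0 -> v0 != 0 ->
  rho = 1 + 4 / kappa ->
  forall eta, 0 < eta -> exists2 eps, 0 < eps &
  forall (f : E -> R) (G : E -> E), f 0 = 0 -> G 0 = 0 ->
  (forall a b, `|a| <= 2 * rho -> `|b| <= 2 * rho ->
    `|G b - G a - H (b - a)| <= eps * `|b - a| /\
    `|f b - f a - mxdot (G a) (b - a) - mxdot (H (b - a)) (b - a) / 2|
      <= eps * `|b - a| ^+ 2) ->
  exists p mu, [/\ `|p| <= 2 * rho, `|mu| <= eta, G p + mu *: S p = 0 &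
    0 < mxdot (S p) p].
Proof.
move=> Pv0 v00 rhoE eta eta0.
have [CT CT0 TC] := linear_mx_bounded T.
have [cS cS0 Sdot] := mxdot_linear_le S.
have [cH cH0 Hdot] := mxdot_linear_le H.
have [CH CH0 HC] := linear_mx_bounded H.
have rho1 : 1 <= rho by rewrite rhoE lerDl divr_ge0// ltW.
have rho0 : 0 < rho by exact: lt_le_trans rho1.
(* The minimizer [v] will satisfy [<S v, v> <= 2]: 1 plus a defect of at most 1/2 at [p] plus a
   change of at most 1/2 from [p] to [v]. With [kappa * rho ^+ 2 >= 4] this forces [v] into the
   interior of the ball, and the normalized competitor fits in the ball as well. *)
have krho : 4 <= kappa * rho ^+ 2.
  apply: (@le_trans _ _ (kappa * rho)); last by rewrite ler_pM2l// expr2 ler_peMr// ltW.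
  by rewrite rhoE mulrDr mulr1 mulrCA divff ?gt_eqF// mulr1 lerDr ltW.
pose R0 := 2 * rho; have R00 : 0 < R0 by rewrite mulr_gt0.
have R0W := ltW R00.
have [L L0 penalty] := penalty_bounds R0W.
(* On the graph, [c * B] bounds [p - v], [c * B2] the change of the sphere defect from [v] to [p],
   and [c ^+ 2 * D] the value of [Psi] without the penalty. [X] adds up the constants, so that one
   smallness condition on [c] covers all uses. *)
pose B := CT * (1 + L) * R0.
have CTL0 : 0 <= CT * (1 + L) by rewrite mulr_ge0 ?(ltW CT0) ?addr_ge0.
have B0 : 0 <= B by apply: mulr_ge0.
pose B2 := 2 * cS * B * R0; have B20 : 0 <= B2 by do 2!apply: mulr_ge0 => //; apply: mulr_ge0.
pose D := R0 ^+ 2 + cH * B ^+ 2.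
have D0 : 0 <= D by rewrite addr_ge0 ?sqr_ge0// mulr_ge0 ?sqr_ge0.
pose X := 1 + CT * (1 + L) + 8 * (2 * D + B2 ^+ 2) + B2.
have X0 : 0 < X by rewrite /X; have := sqr_ge0 B2; lra.
have [c [c0 c_le1 c_eta cX]] : exists c, [/\ 0 < c, c <= 1, c <= eta & c * X <= 2^-1].
  exists (Num.min (Num.min 1 eta) (2 * X)^-1); split.
  - by rewrite !lt_min ltr01 eta0 invr_gt0 mulr_gt0.
  - by rewrite !ge_min lexx.
  - by rewrite !ge_min lexx orbT.
  - by rewrite -ler_pdivlMr// -invfM ge_min lexx orbT.
have cW := ltW c0.
have cXle Y : Y <= X -> c * Y <= 2^-1.
  by move=> YX; rewrite (le_trans _ cX)// ler_wpM2l.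
have cCT : c * (CT * (1 + L)) <= 2^-1.
  by apply: cXle; rewrite /X; have := sqr_ge0 B2; lra.
have cD : c * (8 * (2 * D + B2 ^+ 2)) <= 2^-1 by apply: cXle; rewrite /X; lra.
have cB2 : c * B2 <= 2^-1.
  by apply: cXle; rewrite /X; have := sqr_ge0 B2; lra.
clear X X0 cX cXle.
(* With a perturbation of size [c ^+ 2], everything in [Psi] except the penalty is of order [c ^+ 2]
   on the graph, the Hessian term because it is quadratic in [p - v]. The penalty, of order [c],
   then dominates. *)
exists (c ^+ 2); first by rewrite exprn_gt0.
have c2c : c ^+ 2 <= c by rewrite expr2 ler_piMr.
move=> f G f0 G0 fG.
pose g x := G x + c *: (sg x *: S x).
pose Psi x := f x + c * (sg x ^+ 2 / 4).
have zR : `|0 : E| <= R0 by rewrite normr0.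
have gtilde a b : `|a| <= R0 -> `|b| <= R0 ->
    `|g b - H b - (g a - H a)| <= c * (1 + L) * `|b - a|.
  move=> aR bR; have [h1 _] := fG a b aR bR; have [h2 _] := penalty a b aR bR.
  have -> : g b - H b - (g a - H a) =
     G b - G a - H (b - a) + c *: (sg b *: S b - sg a *: S a).
    by rewrite (linearB H) /g; apply/matrixP => i j; rewrite !mxE; ring.
  rewrite (le_trans (ler_normD _ _))// normrZ (gtr0_norm c0).
  rewrite mulrDr mulr1 mulrDl lerD//.
    by rewrite (le_trans h1)// ler_wpM2r.
  by rewrite -mulrA ler_wpM2l.
have g0 : g 0 = 0 by rewrite /g G0 linear0 !scaler0 addr0.
have taylor a b : `|a| <= R0 -> `|b| <= R0 ->
    `|Psi b - Psi a - mxdot (g a) (b - a)| <= (1 + cH + L) * `|b - a| ^+ 2.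
  move=> aR bR; have [_ h1] := fG a b aR bR; have [_ h2] := penalty a b aR bR.
  have -> : Psi b - Psi a - mxdot (g a) (b - a) =
     (f b - f a - mxdot (G a) (b - a) - mxdot (H (b - a)) (b - a) / 2) +
     mxdot (H (b - a)) (b - a) / 2 +
     c * (sg b ^+ 2 / 4 - sg a ^+ 2 / 4 - mxdot (sg a *: S a) (b - a)).
    by rewrite /Psi /g mxdotDl (mxdotZl _ c); ring.
  have d0 : 0 <= `|b - a| ^+ 2 by rewrite sqr_ge0.
  rewrite (le_trans (ler_normD _ _))// [leRHS]mulrDl lerD//.
    rewrite (le_trans (ler_normD _ _))// [leRHS]mulrDl lerD//.
      by rewrite (le_trans h1)// ler_wpM2r// (le_trans c2c).
    rewrite normrM (ger0_norm (_ : 0 <= 2^-1 :> R))//.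
    apply: (@le_trans _ _ `|mxdot (H (b - a)) (b - a)|).
      by rewrite ler_piMr// invf_le1// ler1n.
    by rewrite (le_trans (Hdot _ _))// expr2.
  by rewrite normrM (gtr0_norm c0) (le_trans _ h2)// ler_piMl.
have gB : exists B, forall a, `|a| <= R0 -> `|g a| <= B.
  exists ((c * (1 + L) + CH) * R0) => a aR.
  have := gtilde 0 a zR aR; rewrite g0 linear0 !subr0 => h1.
  rewrite -(subrK (H a) (g a)) (le_trans (ler_normD _ _))// mulrDl lerD//.
    by rewrite (le_trans h1)// ler_wpM2l// mulr_ge0// addr_ge0.
  by rewrite (le_trans (HC _))// ler_wpM2l// ltW.
have gT a b : `|a| <= R0 -> `|b| <= R0 ->
    `|T (g b - H b - (g a - H a))| <= 2^-1 * `|b - a|.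
  move=> aR bR; rewrite (le_trans (TC _))//.
  apply: (@le_trans _ _ (CT * (c * (1 + L) * `|b - a|))).
    by rewrite ler_wpM2l ?gtilde// ltW.
  by rewrite mulrA ler_wpM2r// mulrCA.
have C0 : 0 <= 1 + cH + L by rewrite !addr_ge0.
have [p [v [Pv vr pR pE [pmin pcrit]]]] :=
  reduced_critical_point HT PT PH HP Psym rho0 C0 g0 gT taylor gB.
(* Both comparison estimates below come from [p - v = O(c)] and [H v = 0]. *)
have estim p' v' : P v' = v' -> `|v'| <= rho -> `|p'| <= R0 ->
    p' = v' - T (g p' - H p') ->
    `|Psi p' - c / 4 * sg p' ^+ 2| <= c ^+ 2 * D /\
    `|sg p' - sg v'| <= c * B2.
  move=> Pv' v'r p'R p'E; set w := p' - v'.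
  have wle : `|w| <= c * B.
    have -> : w = - T (g p' - H p') by rewrite /w {1}p'E addrC addKr.
    rewrite normrN (le_trans (TC _))//.
    have := gtilde 0 p' zR p'R; rewrite g0 linear0 !subr0 => h.
    have -> : c * B = CT * (c * (1 + L) * R0) by rewrite /B; ring.
    by rewrite ler_wpM2l ?(ltW CT0)// (le_trans h)// ler_wpM2l// mulr_ge0// addr_ge0.
  have p'w : p' = v' + w by rewrite /w addrC subrK.
  have Hv' : H v' = 0 by rewrite -Pv' HP.
  split.
    have -> : Psi p' - c / 4 * sg p' ^+ 2 = f p' by rewrite /Psi; ring.
    have [_] := fG 0 p' zR p'R; rewrite f0 G0 mxdot0l !subr0 => h1.
    have h2 : `|mxdot (H p') p' / 2| <= c ^+ 2 * (cH * B ^+ 2).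
      have -> : mxdot (H p') p' = mxdot (H w) w.
        by rewrite Hsym p'w linearD Hv' add0r mxdotDl -Hsym Hv' mxdot0l add0r -Hsym.
      rewrite normrM (ger0_norm (_ : 0 <= 2^-1 :> R))//.
      apply: (@le_trans _ _ `|mxdot (H w) w|).
        by rewrite ler_piMr// invf_le1// ler1n.
      rewrite (le_trans (Hdot _ _))// [leRHS]mulrCA -exprMn ler_wpM2l// expr2.
      by rewrite ler_pM.
    rewrite -(subrK (mxdot (H p') p' / 2) (f p')) (le_trans (ler_normD _ _))//.
    rewrite /D mulrDr lerD// (le_trans h1)// ler_wpM2l ?sqr_ge0//.
    by rewrite lerXn2r// nnegrE.
  rewrite sphere_defectB -/w (le_trans (ler_normD _ _))//.
  have v'R : `|v'| <= R0 by rewrite (le_trans v'r)// ler_peMl ?(ltW rho0)// ler1n.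
  have -> : c * B2 = cS * (c * B * R0) + cS * (c * B * R0) by rewrite /B2; ring.
  by rewrite lerD// (le_trans (Sdot _ _))// ler_wpM2l// ler_pM.
have s00 : 0 < mxdot (S v0) v0.
  by apply: lt_le_trans (Spos Pv0); rewrite mulr_gt0// exprn_gt0// normr_gt0.
pose v1 := (Num.sqrt (mxdot (S v0) v0))^-1 *: v0.
have Pv1 : P v1 = v1 by rewrite linearZ /= Pv0.
have s1 : mxdot (S v1) v1 = 1.
  rewrite linearZ /= mxdotZl mxdotZr mulrA -invfM -expr2 sqr_sqrtr ?ltW//.
  by rewrite mulVf// gt_eqF.
have v1r : `|v1| <= rho.
  have := Spos Pv1; rewrite s1 => h.
  have : kappa * `|v1| ^+ 2 <= kappa * rho ^+ 2.
    by rewrite (le_trans h)// (le_trans _ krho)// ler1n.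
  by rewrite ler_pM2l// ler_pXn2r// nnegrE// ltW.
have [p1 [p1R p1E p1min]] := pmin v1 Pv1 v1r.
have [e1 e2] := estim p1 v1 Pv1 v1r p1R p1E.
have [e3 e4] := estim p v Pv vr pR pE.
rewrite {2}/sphere_defect s1 subrr subr0 in e2.
have k5 : `|sg p| <= 2^-1.
  apply: (penalty_comparison c0 c_le1 _ e3 e1 e2 p1min).
  have -> : c * (16 * (2 * D + B2 ^+ 2)) = 2 * (c * (8 * (2 * D + B2 ^+ 2))) by ring.
  lra.
have vlt : `|v| < rho.
  have h := Spos Pv.
  have : kappa * `|v| ^+ 2 < kappa * rho ^+ 2.
    apply: le_lt_trans h _; apply: lt_le_trans krho.
    move: e4 k5; rewrite !ler_norml /sphere_defect => /andP[k6 _] /andP[_ k7].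
    lra.
  by rewrite ltr_pM2l// ltr_pXn2r// nnegrE// ltW.
exists p, (c * sg p); split=> //.
- rewrite normrM (gtr0_norm c0) (le_trans _ c_eta)// ler_piMr// (le_trans k5)//.
  by rewrite invf_le1// ler1n.
- by have := pcrit vlt; rewrite /g scalerA.
- by move: k5; rewrite ler_norml /sphere_defect => /andP[k5 _]; lra.
Qed.

End GradientBifurcation.

(** * From global estimates on a ball to a neighbourhood of a critical point *)

Section GradientBifurcationLocal.
Context {R : realType} {m n : nat}.
Local Notation E := 'M[R]_(m, n).

Lemma sdiff_quadratic (L : {linear E -> E}) (p0 p : E) :
  (forall a b, mxdot (L a) b = mxdot a (L b)) ->
  sdiff (fun q => mxdot (L (q - p0)) (q - p0)) p (2 *: L (p - p0)).
Proof.
move=> Lsym e e0; have [c c0 Lc] := mxdot_linear_le L.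
have c1 : 0 < 1 + c by rewrite ltr_pwDl.
pose d := e / (2 * (1 + c)); have d0 : 0 < d by rewrite divr_gt0// mulr_gt0.
have : \forall z \near (p, p), `|z.1 - p| <= d /\ `|z.2 - p| <= d.
  exists ([set a | `|a - p| < d], [set a | `|a - p| < d]) => /=.
    by split; exact: near_mx_lt.
  by move=> [a b] [/= /ltW h1 /ltW h2].
apply: filterS => -[a b] /= [ad bd].
have -> : mxdot (L (b - p0)) (b - p0) - mxdot (L (a - p0)) (a - p0) -
    mxdot (2 *: L (p - p0)) (b - a) = mxdot (L (b - a)) ((b - p) + (a - p)).
  have e1 : b - p0 = (b - p) + (p - p0) by rewrite addrA subrK.
  have e2 : a - p0 = (a - p) + (p - p0) by rewrite addrA subrK.
  have e3 : b - a = (b - p) - (a - p) by rewrite opprB addrA subrK.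
  rewrite e1 e2 e3; move: (b - p) (a - p) (p - p0) => u v w.
  rewrite [L (u + w)]linearD [L (v + w)]linearD [L (u - v)]linearB /=.
  rewrite mxdotZl !(mxdotDl, mxdotDr, mxdotNl, mxdotNr).
  have sym x y : mxdot (L x) y = mxdot (L y) x by rewrite Lsym mxdotC.
  by rewrite (sym u w) (sym v w) (sym u v); ring.
rewrite (le_trans (Lc _ _))//.
apply: (@le_trans _ _ (c * (`|b - a| * (d + d)))).
  by rewrite ler_wpM2l// ler_wpM2l// (le_trans (ler_normD _ _))// lerD.
have -> : d + d = e / (1 + c) by rewrite /d; field; rewrite gt_eqF.
rewrite [leRHS]mulrC mulrCA ler_wpM2l// mulrCA ger_pMr// ler_pdivrMr//; lra.
Qed.

Lemma near_ball_pair (p : E) (Q : E * E -> Prop) : (\forall z \near (p, p), Q z) ->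
  exists2 d : R, 0 < d & forall a b, `|a - p| < d -> `|b - p| < d -> Q (a, b).
Proof.
move=> [[A B] /= [Ap Bp] AB].
have /(@nbhs_normP R E)[d1 /= d10 dA] := Ap.
have /(@nbhs_normP R E)[d2 /= d20 dB] := Bp.
exists (Num.min d1 d2); first by rewrite lt_min d10.
move=> a b; rewrite !lt_min => /andP[a1 _] /andP[_ b2]; apply: AB; split=> /=.
  by apply: dA; rewrite /= distrC.
by apply: dB; rewrite /= distrC.
Qed.

(** The mean value theorem applied to [f] minus half the quadratic form of [H]: its gradient [G - H]
    has a small Lipschitz constant near [p]. Only the gradient near [p] and its linear part at [p]
    enter. The division by [1 + m n] compensates the constant of [mxdot_le]. *)
Lemma taylor_of_sdiff_gradient (f : E -> R) (G : E -> E) (H : {linear E -> E})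
    (p : E) : (forall a b, mxdot (H a) b = mxdot a (H b)) ->
  (\forall q \near p, sdiff f q (G q)) ->
  (forall e, 0 < e -> \forall z \near (p, p),
    `|G z.2 - G z.1 - H (z.2 - z.1)| <= e * `|z.2 - z.1|) ->
  forall e, 0 < e -> exists2 d : R, 0 < d &
  forall a b, `|a - p| < d -> `|b - p| < d ->
    `|G b - G a - H (b - a)| <= e * `|b - a| /\
    `|f b - f a - mxdot (G a) (b - a) - mxdot (H (b - a)) (b - a) / 2|
      <= e * `|b - a| ^+ 2.
Proof.
move=> Hsym fG GH e e0.
have N1 : 0 < 1 + (m * n)%:R :> R by rewrite ltr_pwDl.
pose e' := e / (1 + (m * n)%:R); have e'0 : 0 < e' by rewrite divr_gt0.
have e'N : (m * n)%:R * e' <= e.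
  by rewrite /e' mulrCA ger_pMr// ler_pdivrMr//; lra.
have e'e : e' <= e by rewrite ler_pdivrMr// ler_peMr ?(ltW e0)// lerDl.
have [d1 d10 dG] := near_ball_pair (GH _ e'0).
have /(@nbhs_normP R E)[d2 /= d20 df] := fG.
exists (Num.min d1 d2); first by rewrite lt_min d10.
move=> a b; rewrite !lt_min => /andP[a1 a2] /andP[b1 b2].
split; first by rewrite (le_trans (dG _ _ a1 b1))// ler_wpM2r.
pose k x := f x - mxdot (H (x - 0)) (x - 0) / 2.
have seg (t : R) : 0 <= t <= 1 -> forall d, `|a - p| < d -> `|b - p| < d ->
    `|a + t *: (b - a) - p| < d.
  move=> /andP[t0 t1] d ad bd.
  have -> : a + t *: (b - a) - p = (1 - t) *: (a - p) + t *: (b - p).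
    by apply/matrixP => i j; rewrite !mxE; ring.
  have [->|tn0] := eqVneq t 0; first by rewrite subr0 scale1r scale0r addr0.
  have tp : 0 < t by rewrite lt_def tn0.
  rewrite (le_lt_trans (ler_normD _ _))// !normrZ (ger0_norm t0) ger0_norm ?subr_ge0//.
  have h1 : (1 - t) * `|a - p| <= (1 - t) * d by rewrite ler_wpM2l ?subr_ge0// ltW.
  have h2 : t * `|b - p| < t * d by rewrite ltr_pM2l.
  lra.
have [t t01 kE] : exists2 t : R, 0 <= t <= 1 &
    k b - k a = mxdot (G (a + t *: (b - a)) - H (a + t *: (b - a))) (b - a).
  apply: (@sdiff_MVT _ _ _ k a b (fun x => G x - H x)) => t t01.
  set x := a + _.
  have dfx : sdiff f x (G x) by apply: df; rewrite /= distrC seg.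
  have := sdiffD dfx (sdiffZ (- 2^-1) (sdiff_quadratic 0 x Hsym)).
  rewrite subr0 scalerA (_ : - 2^-1 * 2 = -1 :> R); last by field.
  by rewrite scaleN1r; apply: sdiff_ext => q; rewrite /k; field.
have -> : f b - f a - mxdot (G a) (b - a) - mxdot (H (b - a)) (b - a) / 2 =
    k b - k a - mxdot (G a - H a) (b - a).
  rewrite /k !subr0 [H (b - a)]linearB /=.
  have sym : mxdot (H b) a = mxdot (H a) b by rewrite Hsym mxdotC.
  by rewrite !(mxdotDl, mxdotDr, mxdotNl, mxdotNr) sym; field.
rewrite kE -mxdotBl (le_trans (mxdot_le _ _))//.
set c := a + t *: (b - a).
have -> : G c - H c - (G a - H a) = G c - G a - H (c - a).
  by rewrite [H (c - a)]linearB; apply/matrixP => i j; rewrite !mxE; ring.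
have ca : `|c - a| <= `|b - a|.
  have -> : c - a = t *: (b - a) by rewrite /c addrC addKr.
  have /andP[t0 t1] := t01.
  by rewrite normrZ ger0_norm// ler_piMl.
have h := dG a c a1 (seg _ t01 _ a1 b1).
apply: (@le_trans _ _ ((m * n)%:R * e' * `|b - a| ^+ 2)); last first.
  by rewrite ler_wpM2r ?sqr_ge0.
rewrite -mulrA ler_wpM2l// expr2 mulrA ler_wpM2r//.
by rewrite (le_trans h)// ler_wpM2l// ltW.
Qed.

Variables H T P S : {linear E -> E}.
Hypothesis HT : forall x, H (T x) = x - P x.
Hypothesis PT : forall x, P (T x) = 0.
Hypothesis PH : forall x, P (H x) = 0.
Hypothesis HP : forall x, H (P x) = 0.
Hypothesis Psym : forall a b, mxdot (P a) b = mxdot a (P b).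
Hypothesis Hsym : forall a b, mxdot (H a) b = mxdot a (H b).
Hypothesis Ssym : forall a b, mxdot (S a) b = mxdot a (S b).
Variable kappa : R.
Hypothesis kappa_gt0 : 0 < kappa.
Hypothesis Spos : forall v, P v = v -> kappa * `|v| ^+ 2 <= mxdot (S v) v.

(** A blow-up at [p0]: the functions [(f (p0 + r x) - f p0) / r ^ 2] approach the quadratic form of
    [H] divided by 2 on a fixed ball as [r] tends to 0, so [penalized_critical_point] applies to
    them. The multiplier is unchanged when scaling back, because both terms of the equation have the
    same degree in [r]. *)
Lemma gradient_bifurcation (f : E -> R) (G : E -> E) (p0 v0 : E) :
  P v0 = v0 -> v0 != 0 -> G p0 = 0 ->
  (\forall q \near p0, sdiff f q (G q)) ->
  (forall e, 0 < e -> \forall z \near (p0, p0),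
    `|G z.2 - G z.1 - H (z.2 - z.1)| <= e * `|z.2 - z.1|) ->
  forall eta, 0 < eta -> exists p mu, [/\ `|p - p0| < eta, `|mu| < eta,
    G p + mu *: S (p - p0) = 0 & 0 < mxdot (S (p - p0)) (p - p0)].
Proof.
move=> Pv0 v00 Gp0 fG GH eta eta0.
pose rho := 1 + 4 / kappa.
have eta20 : 0 < eta / 2 by rewrite divr_gt0.
have [eps eps0 core] := penalized_critical_point HT PT PH HP Psym Hsym Ssym
  kappa_gt0 Spos Pv0 v00 (erefl rho) eta20.
have [d d0 tay] := taylor_of_sdiff_gradient Hsym fG GH eps0.
have rho0 : 0 < rho by rewrite ltr_wpDr// divr_ge0// ltW.
pose r := Num.min d eta / (2 * rho + 1).
have r0 : 0 < r by rewrite divr_gt0 ?lt_min ?d0// ltr_wpDl// mulr_ge0// ltW.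
have rball (x : E) : `|x| <= 2 * rho -> `|r *: x| < Num.min d eta.
  move=> xr; rewrite normrZ gtr0_norm// /r mulrAC ltr_pdivrMr ?ltr_wpDl ?mulr_ge0 ?(ltW rho0)//.
  rewrite ltr_pM2l ?lt_min ?d0//; lra.
have rd (x : E) : `|x| <= 2 * rho -> `|p0 + r *: x - p0| < d.
  by move=> /rball; rewrite lt_min [p0 + _]addrC addrK => /andP[].
pose fr x := (f (p0 + r *: x) - f p0) / r ^+ 2.
pose Gr x := r^-1 *: G (p0 + r *: x).
have [||a b aR bR|p [mu [pR muh crit Spp]]] := core fr Gr.
- by rewrite /fr scaler0 addr0 subrr mul0r.
- by rewrite /Gr scaler0 addr0 Gp0 scaler0.
- have [h1 h2] := tay _ _ (rd _ aR) (rd _ bR).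
  have e1 : p0 + r *: b - (p0 + r *: a) = r *: (b - a).
    by apply/matrixP => i j; rewrite !mxE; ring.
  move: h1 h2; rewrite e1 normrZ (gtr0_norm r0) => h1 h2.
  have rn : r != 0 by rewrite gt_eqF.
  split.
    have -> : Gr b - Gr a - H (b - a) = r^-1 *:
       (G (p0 + r *: b) - G (p0 + r *: a) - H (r *: (b - a))).
      by rewrite [H (r *: _)]linearZ /= /Gr !scalerBr scalerA mulVf// scale1r.
    rewrite normrZ gtr0_norm ?invr_gt0// mulrC ler_pdivrMr//.
    by rewrite (le_trans h1)// mulrCA mulrC -mulrA.
  have -> : fr b - fr a - mxdot (Gr a) (b - a) - mxdot (H (b - a)) (b - a) / 2 =
     (f (p0 + r *: b) - f (p0 + r *: a) - mxdot (G (p0 + r *: a)) (r *: (b - a)) -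
       mxdot (H (r *: (b - a))) (r *: (b - a)) / 2) / r ^+ 2.
    by rewrite [H (r *: _)]linearZ /= !mxdotZl !mxdotZr /fr /Gr ?mxdotZl; field.
  rewrite normrM (gtr0_norm (_ : 0 < (r ^+ 2)^-1)) ?invr_gt0 ?exprn_gt0//.
  rewrite ler_pdivrMr ?exprn_gt0// (le_trans h2)// exprMn.
  by rewrite mulrCA mulrC mulrA.
exists (p0 + r *: p), mu; rewrite [p0 + _ - _]addrC addKr; split.
- by have := rball _ pR; rewrite lt_min => /andP[].
- by rewrite (le_lt_trans muh)// ltr_pdivrMr// ltr_pMr// ltr1n.
- rewrite [S (r *: p)]linearZ /=; move: crit; rewrite /Gr => /(congr1 ( *:%R r)).
  by rewrite scalerDr scaler0 !scalerA divff ?gt_eqF// scale1r [r * mu]mulrC.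
- by rewrite [S (r *: p)]linearZ /= mxdotZl mxdotZr mulr_gt0// mulr_gt0.
Qed.

End GradientBifurcationLocal.

(** * Symmetric matrices *)

Section SymmetricMatrices.
Context {R : realType}.

Lemma mulmx_tr_eq0 m n (A : 'M[R]_(m, n)) : A *m A^T = 0 -> A = 0.
Proof.
move=> AA; rewrite -[A]trmxK (mxdot_eq0 (a := A^T)) ?trmx0//.
by rewrite /mxdot trmxK AA mxtrace0.
Qed.

Lemma unitmx_ker0 n (A : 'M[R]_n) :
  (forall m (K : 'M[R]_(m, n)), K *m A = 0 -> K = 0) -> A \in unitmx.
Proof.
by move=> Ainj; rewrite -row_free_unit -kermx_eq0; apply/eqP/Ainj; exact: mulmx_ker.
Qed.

(* [P] is the orthogonal projection onto the kernel of [A] and [T] inverts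
   [A] on the orthogonal complement. *)
Lemma symmetric_pseudoinverse n (A : 'M[R]_n) : A^T = A ->
  exists P T : 'M[R]_n, [/\ P^T = P, P *m A = 0 /\ A *m P = 0,
    A *m T = 1%:M - P, T *m A = 1%:M - P & P *m T = 0].
Proof.
move=> Asym; pose V := row_base (kermx A).
have VA : V *m A = 0.
  by apply/eqP; rewrite -sub_kermx eq_row_base.
have Vfree : row_free V by exact: row_base_free.
have Vsub r (K : 'M[R]_(r, n)) : K *m A = 0 -> (K <= V)%MS.
  by rewrite eq_row_base sub_kermx => ->.
clearbody V.
have Gu : V *m V^T \in unitmx.
  apply: unitmx_ker0 => m K KV.
  have /mulmx_tr_eq0 KV0 : (K *m V) *m (K *m V)^T = 0.
    by rewrite trmx_mul -mulmxA [V *m _]mulmxA mulmxA KV mul0mx.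
  by apply: (row_free_inj Vfree); rewrite KV0 mul0mx.
pose P := V^T *m invmx (V *m V^T) *m V.
have VP : V *m P = V by rewrite /P !mulmxA mulmxV// mul1mx.
have PA : P *m A = 0 by rewrite /P -mulmxA VA mulmx0.
have PT : P^T = P.
  by rewrite /P !trmx_mul trmx_inv trmx_mul !trmxK mulmxA.
have AP : A *m P = 0 by rewrite -Asym -PT -trmx_mul PA trmx0.
have PP : P *m P = P by rewrite {1}/P -mulmxA VP.
(* [A] and [P] live on complementary orthogonal subspaces, so [A + P] is invertible; its inverse is
   the identity on the kernel, and subtracting [P] leaves the inverse of [A] on the complement. *)
have APu : A + P \in unitmx.
  apply: unitmx_ker0 => m K KAP.
  have KP : K *m P = 0.
    have : K *m (A + P) *m P = 0 by rewrite KAP mul0mx.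
    by rewrite -mulmxA mulmxDl AP PP add0r.
  have : (K <= V)%MS by apply: Vsub; rewrite -KAP mulmxDr KP addr0.
  by case/submxP => D KD; move: KP; rewrite KD -mulmxA VP.
have P1 : P *m invmx (A + P) = P.
  have h : P *m (A + P) = P by rewrite mulmxDr PA PP add0r.
  by rewrite -[X in X *m _]h mulmxK.
have P2 : invmx (A + P) *m P = P.
  have h : (A + P) *m P = P by rewrite mulmxDl AP PP add0r.
  by rewrite -[X in _ *m X]h mulKmx.
exists P, (invmx (A + P) - P); split=> //.
- rewrite mulmxBr AP subr0; apply/eqP; rewrite eq_sym subr_eq.
  by rewrite -[X in _ + X]P1 -mulmxDl mulmxV.
- rewrite mulmxBl PA subr0; apply/eqP; rewrite eq_sym subr_eq.
  by rewrite -[X in _ + X]P2 -mulmxDr mulVmx.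
- by rewrite mulmxBr P1 PP subrr.
Qed.

End SymmetricMatrices.

Section PlanarBlocksLinear.
Context {R : realType} {n : nat}.
Variables A C : 'M[R]_n.

Fact xyblock_linear : linear (xyblock A C).
Proof. by move=> k p q; rewrite xyblockD xyblockZ. Qed.

HB.instance Definition _ := GRing.isLinear.Build R 'M[R]_(n, 2) 'M[R]_(n, 2)
  *:%R (xyblock A C) xyblock_linear.
End PlanarBlocksLinear.

(** * Balanced configurations *)

Section PotentialGeometry.
Context {R : realType} {n : nat}.
Variable m : 'I_n -> R.
Local Notation E := 'M[R]_(n, 2).
Implicit Types (p q v : E) (s : R).

Definition SM_grad s q : E := xyblock (s *: mass_mx m) (mass_mx m) q.

Lemma mass_mxE r (v : 'M[R]_(n, r)) i k : (mass_mx m *m v) i k = m i * v i k.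
Proof. by rewrite /mass_mx mul_diag_mx !mxE. Qed.

Lemma SM_grad0 s q i : SM_grad s q i 0 = s * (m i * q i 0).
Proof. by rewrite xyblock0 -scalemxAl mxE mass_mxE. Qed.

Lemma SM_grad1 s q i : SM_grad s q i 1 = m i * q i 1.
Proof. by rewrite xyblock1 mass_mxE. Qed.

Lemma sum_ord2 (F : 'I_2 -> R) : \sum_i F i = F 0 + F 1.
Proof.
by rewrite big_ord_recl big_ord1; congr (_ + F _); apply: val_inj.
Qed.

Lemma SM_formE s q v : SM_form m s q v = mxdot (SM_grad s q) v.
Proof.
rewrite mxdotE; apply: eq_bigr => i _.
by rewrite sum_ord2 SM_grad0 SM_grad1; ring.
Qed.

Lemma centeredP q : centered m q <-> forall k, \sum_i m i * q i k = 0.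
Proof.
rewrite /centered; split=> [/matrixP c k|c].
  have := c 0 k; rewrite summxE mxE => e; rewrite -{}[RHS]e.
  by apply: eq_bigr => i _; rewrite !mxE.
apply/matrixP => i k; rewrite summxE mxE -[RHS](c k).
by apply: eq_bigr => j _; rewrite !mxE.
Qed.

Lemma collision_free_dist q :
  (forall i j, i != j -> 0 < dist q i j) -> collision_free q.
Proof.
move=> d0 i j ij; apply: contraTneq (d0 i j ij) => /matrixP rij.
have h k : q i k = q j k by have := rij 0 k; rewrite !mxE.
by rewrite /dist !h !subrr expr0n addr0 sqrtr0 ltxx.
Qed.

Lemma near_collision_free q : collision_free q ->
  \forall p \near q, collision_free p.
Proof.
move=> cf.
pose Q (ij : 'I_n * 'I_n) (p : E) := ij.1 != ij.2 -> 0 < dist p ij.1 ij.2.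
have HQ ij : \forall p \near q, Q ij p.
  case: ij => i j; rewrite /Q /=.
  have [->|ij] := eqVneq i j; first by near=> p.
  have s1 := sdiffD (sdiff_sqr (sdiff_diff i j 0 q)) (sdiff_sqr (sdiff_diff i j 1 q)).
  have := dist_gt0 cf ij; rewrite sqrtr_gt0 => d0.
  have pos : \forall p \near q, 0 < ((p : E) i 0 - p j 0) ^+ 2 + (p i 1 - p j 1) ^+ 2.
    exact: (sdiff_continuous s1 (lt_nbhsr d0)).
  near=> p => _; rewrite sqrtr_gt0; near: p; exact: pos.
have : \forall p \near q, forall ij, Q ij p by exact: (@filter_forall _ _ Q _ _ HQ).
by apply: filterS => p pd; apply: collision_free_dist => i j; exact: (pd (i, j)).
Unshelve. all: by end_near. Qed.

Lemma potential_gt0 q : (2 <= n)%N -> (forall i, 0 < m i) ->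
  collision_free q -> 0 < potential m q.
Proof.
move=> n2 m0 cf.
have pos i j : i != j -> 0 < m i * m j / dist q i j.
  by move=> ij; rewrite divr_gt0 ?mulr_gt0// dist_gt0.
pose i0 := Ordinal (ltnW n2); pose i1 := Ordinal n2.
rewrite /potential (bigD1 i0)//= (bigD1 i1)//=.
apply: ltr_pwDl; last apply: sumr_ge0 => i _.
  apply: ltr_pwDl; first exact: pos.
  by apply: sumr_ge0 => j /andP[ij _]; apply/ltW/pos; rewrite neq_ltn ij.
by apply: sumr_ge0 => j ij; apply/ltW/pos; rewrite neq_ltn ij.
Qed.

(** Euler's identity for a function homogeneous of degree -1; it identifies the Lagrange multiplier
    as the value of the potential. *)
Lemma euler_potential q : collision_free q ->
  mxdot (gradU m q) q = - potential m q.
Proof.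
move=> cf; rewrite gradU_dot /potential -sumrN; apply: eq_bigr => i _.
rewrite -sumrN; apply: eq_bigr => j ij.
have d0 : 0 < dist q i j by rewrite dist_gt0// neq_ltn ij.
have -> : (q i 0 - q j 0) * (q i 0 - q j 0) + (q i 1 - q j 1) * (q i 1 - q j 1) = dist q i j ^+ 2.
  by rewrite sqr_sqrtr ?addr_ge0 ?sqr_ge0// !expr2.
by field; rewrite gt_eqF.
Qed.

Lemma gradU_translation q v : (forall i j k, v i k = v j k) ->
  mxdot (gradU m q) v = 0.
Proof.
move=> vc; rewrite gradU_dot big1// => i _; rewrite big1// => j _.
by rewrite !(vc i j) !subrr !mulr0 addr0 !mulr0.
Qed.

Lemma distZ (k : R) q i j : 0 < k -> dist (k *: q) i j = k * dist q i j.
Proof.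
move=> k0; rewrite /dist !mxE -!mulrBr !exprMn -mulrDr sqrtrM ?sqr_ge0//.
by rewrite sqrtr_sqr gtr0_norm.
Qed.

Lemma collision_freeZ (k : R) q : 0 < k -> collision_free q -> collision_free (k *: q).
Proof.
move=> k0 cf; apply: collision_free_dist => i j ij.
by rewrite distZ// mulr_gt0// dist_gt0.
Qed.

Lemma gradUZ (k : R) q : 0 < k -> gradU m (k *: q) = k ^- 2 *: gradU m q.
Proof.
move=> k0; apply/matrixP => i l; rewrite !mxE mulr_sumr; apply: eq_bigr => j _.
have kn : k != 0 by rewrite gt_eqF.
rewrite distZ// !mxE invfM exprMn -mulrBr.
have -> : (k^-1) ^+ 3 = k ^- 2 / k by rewrite exprSr exprVn.
by move: (dist _ _ _)^-1 => d; field.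
Qed.

(** The gradient equation alone is enough. Testing it on translations forces the center of mass to
    0, since [s] and [c] are positive. Euler's identity gives [SM_form m s p p = potential m p / c],
    which fixes the normalizing factor, and homogeneity of the gradient preserves criticality. *)
Lemma SBC_of_equation (s c : R) p : (2 <= n)%N -> (forall i, 0 < m i) ->
  0 < s -> 0 < c -> collision_free p -> gradU m p = - c *: SM_grad s p ->
  SBC m s ((Num.sqrt (c^-1 * potential m p))^-1 *: p).
Proof.
move=> n2 m0 s0 c0 cf eqn.
have U0 := potential_gt0 n2 m0 cf.
set r := Num.sqrt _; have r0 : 0 < r by rewrite sqrtr_gt0 mulr_gt0 ?invr_gt0.
have ri0 : 0 < r^-1 by rewrite invr_gt0.
have cf' := collision_freeZ ri0 cf.
have UE : potential m p = c * SM_form m s p p.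
  by have := euler_potential cf; rewrite eqn mxdotZl SM_formE; lra.
have r2 : r ^+ 2 = SM_form m s p p.
  rewrite sqr_sqrtr; last by rewrite mulr_ge0 ?invr_ge0 ?ltW.
  by rewrite UE mulrA mulVf ?mul1r// gt_eqF.
have SMl (k : R) v w : SM_form m s (k *: v) w = k * SM_form m s v w.
  by rewrite !SM_formE /SM_grad xyblockZ mxdotZl.
split.
  split=> //.
    apply/centeredP => k.
    have trans := @gradU_translation p (\matrix_(i, l) (l == k)%:R).
    have {}trans : SM_form m s p (\matrix_(i, l) (l == k)%:R) = 0.
      apply: (mulfI (lt0r_neq0 c0)); rewrite mulr0 SM_formE.
      apply: oppr_inj; rewrite oppr0 -mulNr -mxdotZl -eqn.
      by apply: trans => i j l; rewrite !mxE.
    transitivity (r^-1 * \sum_i m i * p i k).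
      by rewrite mulr_sumr; apply: eq_bigr => i _; rewrite mxE mulrCA.
    apply/eqP; rewrite mulf_eq0 gt_eqF//=; apply/eqP.
    move: trans; rewrite /SM_form; have [->|k1] := eqVneq k 0.
      move=> h; apply: (mulfI (lt0r_neq0 s0)); rewrite mulr0 -[RHS]h mulr_sumr.
      by apply: eq_bigr => i _; rewrite !mxE /=; ring.
    have -> : k = 1 by apply: val_inj; case: k k1 => -[|[|]].
    move=> h; rewrite -[RHS]h; apply: eq_bigr => i _.
    by rewrite !mxE /=; ring.
  rewrite SMl SM_formE mxdotC /SM_grad mxdotZl mxdotC -SM_formE -r2 mulrA -invfM.
  by rewrite -expr2 mulVf// gt_eqF ?exprn_gt0.
move=> v [_]; rewrite SMl => /eqP; rewrite mulf_eq0 gt_eqF//= => /eqP pv.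
by rewrite derive_potential// gradUZ// mxdotZl eqn mxdotZl -SM_formE pv !mulr0.
Qed.

(** The multiplier rule, obtained by hand: removing from [v] its component along [q] and the
    translation [c] by its center of mass leaves a tangent vector. The translation does not affect
    the pairing with the gradient, and Euler's identity evaluates the component along [q]. *)
Lemma SBC_equation (s : R) q : (forall i, 0 < m i) -> (0 < n)%N ->
  SBC m s q -> gradU m q = - potential m q *: SM_grad s q.
Proof.
move=> m0 n0 [[/centeredP cq cf sq] crit].
suff eqn v : mxdot (gradU m q) v = - potential m q * SM_form m s q v.
  apply/matrixP => i k; rewrite -!mxdot_delta !(mxdotC (delta_mx _ _)) eqn.
  by rewrite mxdotZl SM_formE.
pose M := \sum_i m i.
have M0 : 0 < M.
  rewrite /M (bigD1 (Ordinal n0))//= ltr_pwDl// sumr_ge0// => i _.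
  exact: ltW.
pose a := SM_form m s q v.
pose c : E := \matrix_(i, k) ((\sum_j m j * v j k) / M).
have SMc : SM_form m s q c = 0.
  pose d k := (\sum_j m j * v j k) / M.
  transitivity (s * d 0 * (\sum_i m i * q i 0) + d 1 * (\sum_i m i * q i 1)).
    rewrite !mulr_sumr -big_split; apply: eq_bigr => i _ /=.
    by rewrite !mxE /d; ring.
  by rewrite !cq !mulr0 addr0.
have := crit (v - a *: q - c); rewrite derive_potential// => /(_ _).
rewrite !mxdotBr mxdotZr euler_potential// (@gradU_translation q c); last first.
  by move=> i j k; rewrite !mxE.
rewrite subr0 mulrN opprK => h.
suff tan : tangent_space m s q (v - a *: q - c) by have := h tan; rewrite /a; lra.
split; last first.
  by rewrite SM_formE !mxdotBr mxdotZr -!SM_formE SMc sq mulr1 subrr subr0.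
apply/centeredP => k.
transitivity (\sum_i m i * v i k - a * (\sum_i m i * q i k)
   - (\sum_i m i) * ((\sum_j m j * v j k) / M)).
  pose D := (\sum_j m j * v j k) / M; rewrite -/D [_ * D]mulr_suml mulr_sumr -!sumrB.
  by apply: eq_bigr => i _; rewrite !mxE -/D; ring.
by rewrite cq mulr0 subr0 -/M mulrCA divff ?gt_eqF// mulr1 subrr.
Qed.

End PotentialGeometry.

(** * Bifurcation at an eigenvalue *)

Section LaplacianForm.
Context {R : realType} {n : nat}.
Variable m : 'I_n -> R.
Hypothesis m_gt0 : forall i, 0 < m i.
Implicit Types q : 'M[R]_(n, 2).

Lemma B_mx_sym q : (B_mx m q)^T = B_mx m q.
Proof.
apply/matrixP => i j; rewrite !mxE [j == i]eq_sym.
have [->//|_] := eqVneq i j.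
by rewrite distC [m j * _]mulrC.
Qed.

Lemma mass_mx_sym : (mass_mx m)^T = mass_mx m.
Proof. exact: tr_diag_mx. Qed.

Lemma B_mx_form q r (v w : 'M[R]_(n, r)) : mxdot (B_mx m q *m v) w =
  - \sum_(i < n) \sum_(j < n | (i < j)%N) \sum_k
    m i * m j / dist q i j ^+ 3 * ((v i k - v j k) * (w i k - w j k)).
Proof.
rewrite mxdotE.
pose F i j := \sum_k m i * m j / dist q i j ^+ 3 * (v j k - v i k) * w i k.
transitivity (\sum_(i < n) \sum_(j < n | j != i) F i j).
  apply: eq_bigr => i _; rewrite exchange_big; apply: eq_bigr => k _.
  by rewrite B_mxE mulr_suml.
rewrite sum_offdiag -sumrN; apply: eq_bigr => i _; rewrite -sumrN.
apply: eq_bigr => j _; rewrite -sumrN -big_split; apply: eq_bigr => k _ /=.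
by rewrite distC; ring.
Qed.

Lemma B_mx_form_le0 q r (v : 'M[R]_(n, r)) : mxdot (B_mx m q *m v) v <= 0.
Proof.
rewrite B_mx_form oppr_le0; do 3!apply: sumr_ge0 => ? _.
by rewrite -expr2 mulr_ge0 ?sqr_ge0// divr_ge0 ?exprn_ge0 ?sqrtr_ge0// mulr_ge0// ltW.
Qed.

Lemma mass_mx_form r (v : 'M[R]_(n, r)) :
  mxdot (mass_mx m *m v) v = \sum_i \sum_k m i * v i k ^+ 2.
Proof.
rewrite mxdotE; apply: eq_bigr => i _; apply: eq_bigr => k _.
by rewrite mass_mxE -mulrA expr2.
Qed.

(** Coercivity of the mass form in the sup norm. The sum of all inverse masses is a convenient bound
    for each of them; the inverse of this constant later serves as [kappa]. *)
Lemma mass_mx_form_ge r (v : 'M[R]_(n, r)) :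
  `|v| ^+ 2 <= (1 + \sum_i (m i)^-1) * mxdot (mass_mx m *m v) v.
Proof.
set K := \sum_i _; set N := mxdot _ _.
have mi0 i : 0 <= (m i)^-1 by rewrite invr_ge0 ltW.
have K0 : 0 <= K by apply: sumr_ge0.
have pos i k : 0 <= m i * v i k ^+ 2 by rewrite mulr_ge0 ?sqr_ge0// ltW.
have N0 : 0 <= N by rewrite /N mass_mx_form; do 2!apply: sumr_ge0 => ? _.
have KN : 0 <= (1 + K) * N by rewrite mulr_ge0// addr_ge0.
have h i k : `|v i k| <= Num.sqrt ((1 + K) * N).
  rewrite -sqrtr_sqr ler_wsqrtr//.
  have -> : v i k ^+ 2 = (m i)^-1 * (m i * v i k ^+ 2).
    by rewrite mulrA mulVf ?mul1r// gt_eqF.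
  rewrite ler_pM//.
    by rewrite /K (bigD1 i)//= addrCA lerDl addr_ge0// sumr_ge0.
  rewrite /N mass_mx_form (bigD1 i)//= (bigD1 k)//= -addrA lerDl.
  by rewrite addr_ge0// sumr_ge0// => j _; rewrite sumr_ge0.
have := mx_norm_le (sqrtr_ge0 _) h.
by rewrite -ler_sqr ?nnegrE ?sqrtr_ge0// sqr_sqrtr.
Qed.

Lemma radial_hessian_unit q (c : R) : 0 < c ->
  -2 *: B_mx m q + c *: mass_mx m \in unitmx.
Proof.
move=> c0; apply: unitmx_ker0 => r K KC.
set C := _ + _ in KC.
have CT : C^T = C by rewrite /C linearD !linearZ /= B_mx_sym mass_mx_sym.
have h : mxdot (C *m K^T) K^T = 0.
  by rewrite -[C]CT -trmx_mul KC trmx0 mxdot0l.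
move: h; rewrite mulmxDl -!scalemxAl mxdotDl !mxdotZl => h.
have := mass_mx_form_ge K^T; have := B_mx_form_le0 q K^T.
have K0 : 0 <= 1 + \sum_i (m i)^-1.
  by rewrite addr_ge0// sumr_ge0// => i _; rewrite invr_ge0 ltW.
move: h; set b := mxdot _ _; set a := mxdot _ _ => h b0 vle.
have a0 : a <= 0 by rewrite -(ler_pM2l c0) mulr0; lra.
have : `|K^T| ^+ 2 <= 0 by rewrite (le_trans vle)// mulr_ge0_le0.
rewrite le_eqVlt ltNge sqr_ge0 orbF sqrf_eq0 normr_eq0 => /eqP KT.
by rewrite -[K]trmxK KT trmx0.
Qed.

End LaplacianForm.

Section BifurcationAtEigenvalue.
Context {R : realType} {n : nat}.
Variable m : 'I_n -> R.
Hypothesis m_gt0 : forall i, 0 < m i.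
Hypothesis n_ge2 : (2 <= n)%N.
Local Notation E := 'M[R]_(n, 2).

Lemma xyblock_id (p : E) : xyblock 1%:M 1%:M p = p.
Proof. by apply: matrix2P => i; rewrite ?xyblock0 ?xyblock1 mul1mx. Qed.

Lemma xyblock_sub (A A' C C' : 'M[R]_n) (p : E) :
  xyblock (A - A') (C - C') p = xyblock A C p - xyblock A' C' p.
Proof. by rewrite /xyblock !mulmxBl opprD addrACA. Qed.

Lemma xyblock_zero (p : E) : xyblock 0 0 p = 0.
Proof. by rewrite /xyblock !mul0mx addr0. Qed.

(* The multiplier [mu] of [gradient_bifurcation] acts on the [x]-block only, so
   it merely shifts the parameter to [t + mu / U]. *)
Lemma bifurcating_SBC (q : E) (s0 t : R) (x0 : 'cV[R]_n) :
  (forall i, q i 0 = 0) -> SBC m s0 q -> 0 < t -> x0 != 0 ->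
  B_mx m q *m x0 + (t * potential m q) *: (mass_mx m *m x0) = 0 ->
  forall e : R, 0 < e -> exists s q', [/\ `|s - t| < e, `|q' - q| < e,
    SBC m s q' & q' != q].
Proof.
move=> q0 sbc t0 x00 ker e e0.
have [[_ cf _] _] := sbc.
have n_gt0 : (0 < n)%N by exact: leq_trans n_ge2.
have eqn := SBC_equation m_gt0 n_gt0 sbc.
pose U := potential m q.
have U0 : 0 < U by exact: potential_gt0.
pose A := B_mx m q + (t * U) *: mass_mx m.
pose C := -2 *: B_mx m q + U *: mass_mx m.
have Asym : A^T = A by rewrite /A linearD linearZ /= B_mx_sym mass_mx_sym.
have Csym : C^T = C by rewrite /C linearD !linearZ /= B_mx_sym mass_mx_sym.
have Cu : C \in unitmx by exact: radial_hessian_unit.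
have [P0 [T0 [P0T [P0A AP0] AT0 T0A P0T0]]] := symmetric_pseudoinverse Asym.
pose H : {linear E -> E} := xyblock A C.
(* The y-block is invertible, so the kernel of [H] is purely horizontal: [P] vanishes on the
   y-coordinates and [S], the mass form in x, is positive on the range of [P]. *)
pose T : {linear E -> E} := xyblock T0 (invmx C).
pose P : {linear E -> E} := xyblock P0 0.
pose S : {linear E -> E} := xyblock (mass_mx m) 0.
pose W : {linear E -> E} := xyblock ((t * U) *: mass_mx m) (U *: mass_mx m).
have HT x : H (T x) = x - P x.
  rewrite /H /T /P /= xyblock_comp AT0 mulmxV// -[X in xyblock _ X]subr0.
  by rewrite xyblock_sub xyblock_id.
have PT x : P (T x) = 0 by rewrite /P /T /= xyblock_comp P0T0 mul0mx xyblock_zero.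
have PH x : P (H x) = 0 by rewrite /P /H /= xyblock_comp P0A mul0mx xyblock_zero.
have HP x : H (P x) = 0 by rewrite /P /H /= xyblock_comp AP0 mulmx0 xyblock_zero.
have Psym a b : mxdot (P a) b = mxdot a (P b).
  by rewrite /P /= xyblock_dot P0T trmx0.
have Hsym a b : mxdot (H a) b = mxdot a (H b).
  by rewrite /H /= xyblock_dot Asym Csym.
have Ssym a b : mxdot (S a) b = mxdot a (S b).
  by rewrite /S /= xyblock_dot mass_mx_sym trmx0.
have Wsym a b : mxdot (W a) b = mxdot a (W b).
  by rewrite /W /= xyblock_dot !linearZ /= mass_mx_sym.
have SE (x : E) : (forall i, x i 1 = 0) -> S x = mass_mx m *m x.
  move=> x1; rewrite /S /=; apply: matrix2P => i; first by rewrite xyblock0.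
  by rewrite xyblock1 mul0mx mass_mxE x1 mulr0 mxE.
pose K := 1 + \sum_i (m i)^-1.
have K0 : 0 < K.
  by rewrite ltr_pwDl// sumr_ge0// => i _; rewrite invr_ge0 ltW.
have Spos (v : E) : P v = v -> K^-1 * `|v| ^+ 2 <= mxdot (S v) v.
  move=> Pv; have v1 i : v i 1 = 0 by rewrite -Pv /P /= xyblock1 mul0mx mxE.
  by rewrite SE// mulrC ler_pdivrMr// mulrC mass_mx_form_ge.
pose v0 : E := \matrix_(i, k) if k == 0 then x0 i 0 else 0.
have Pv0 : P v0 = v0.
  rewrite /P /=; apply: matrix2P => i; last by rewrite xyblock1 mul0mx !mxE.
  rewrite xyblock0 [RHS]mxE eqxx.
  have -> : (P0 *m v0) i 0 = (P0 *m x0) i 0.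
    by rewrite !mxE; apply: eq_bigr => j _; rewrite !mxE.
  have Ax0 : A *m x0 = 0 by rewrite /A mulmxDl -scalemxAl.
  suff -> : P0 *m x0 = x0 by [].
  apply/eqP; rewrite eq_sym -subr_eq0 -{1}[x0]mul1mx -mulmxBl -T0A -mulmxA Ax0.
  by rewrite mulmx0.
have v00 : v0 != 0.
  apply: contraNneq x00 => /matrixP v00; apply/eqP/matrixP => i j.
  by have := v00 i 0; rewrite !mxE eqxx ord1.
(* The form [p - 0] matches the shape of [sdiff_quadratic]. *)
pose f (p : E) := potential m p + 2^-1 * mxdot (W (p - 0)) (p - 0).
pose G (p : E) := gradU m p + W p.
have Gq : G q = 0.
  rewrite /G eqn /W /=; apply: matrix2P => i.
    rewrite [LHS]mxE [X in X + _]mxE SM_grad0 xyblock0 -scalemxAl.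
    by rewrite [X in _ + X]mxE mass_mxE q0 [RHS]mxE; ring.
  rewrite [LHS]mxE [X in X + _]mxE SM_grad1 xyblock1 -scalemxAl.
  by rewrite [X in _ + X]mxE mass_mxE [RHS]mxE -/U; ring.
have fG : \forall p \near q, sdiff f p (G p).
  have := near_collision_free cf; apply: filterS => p cfp.
  have := sdiffD (sdiff_potential m cfp) (sdiffZ 2^-1 (sdiff_quadratic 0 p Wsym)).
  by rewrite scalerA mulVf ?pnatr_eq0// scale1r subr0.
have GH d : 0 < d -> \forall z \near (q, q),
    `|G z.2 - G z.1 - H (z.2 - z.1)| <= d * `|z.2 - z.1|.
  move=> d0; have := sdiff_gradU m cf q0 d0; apply: filterS => z.
  suff -> : G z.2 - G z.1 - H (z.2 - z.1) = gradU m z.2 - gradU m z.1 -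
    xyblock (B_mx m q) (-2 *: B_mx m q) (z.2 - z.1) by [].
  have -> : H (z.2 - z.1) = xyblock (B_mx m q) (-2 *: B_mx m q) (z.2 - z.1)
      + W (z.2 - z.1).
    rewrite /H /W /=; apply: matrix2P => i.
      by rewrite [RHS]mxE !xyblock0 mulmxDl mxE.
    by rewrite [RHS]mxE !xyblock1 mulmxDl mxE.
  rewrite [W (_ - _)]linearB /G; move: (gradU m _) (gradU m _) (W _) (W _) (xyblock _ _ _).
  by move=> a b c d' h; apply/matrixP => i j; rewrite !mxE; ring.
(* The rescaling of [SBC_of_equation] with [c = U]. It fixes [q] and is continuous there, so
   rescaled solutions stay close to [q]. *)
pose F p : E := (Num.sqrt (U^-1 * potential m p))^-1 *: p.
have Fq : F q = q by rewrite /F -/U mulVf ?gt_eqF// sqrtr1 invr1 scale1r.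
have Fc : \forall p \near q, `|F p - q| < e.
  have e20 : 0 < e / 2 by rewrite divr_gt0.
  pose Q (ik : 'I_n * 'I_2) (p : E) := `|F p ik.1 ik.2 - q ik.1 ik.2| <= e / 2.
  have HQ ik : \forall p \near q, Q ik p.
    have V0 : 0 < U^-1 * potential m q by rewrite mulr_gt0 ?invr_gt0.
    have s1 := sdiff_invsqrt V0 (sdiffZ U^-1 (sdiff_potential m cf)).
    have s2 := sdiffM s1 (sdiff_coord ik.1 ik.2 q).
    have /cvgrPdist_le/(_ _ e20) := sdiff_continuous s2.
    have Fqk : F q ik.1 ik.2 = q ik.1 ik.2 by rewrite Fq.
    apply: filterS => p h; rewrite /Q -Fqk distrC /F !mxE; exact: h.
  have : \forall p \near q, forall ik, Q ik p by exact: (@filter_forall _ _ Q _ _ HQ).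
  apply: filterS => p Qp; apply: (@le_lt_trans _ _ (e / 2)); last by lra.
  by apply: mx_norm_le; [exact: ltW|move=> i k; rewrite !mxE; have := Qp (i, k); rewrite /Q !mxE].
have /(@nbhs_normP R E)[d1 /= d10 cf1] := near_collision_free cf.
have /(@nbhs_normP R E)[d2 /= d20 F2] := Fc.
(* The last factor makes [mu / U] smaller than [e], for [s] to be close to [t], and smaller than
   [t], for [s] to be positive. *)
pose eta := Num.min (Num.min d1 d2) (U * Num.min e t).
have eta0 : 0 < eta by rewrite !lt_min d10 d20 mulr_gt0// lt_min e0.
have K10 : 0 < K^-1 by rewrite invr_gt0.
have [p [mu [pq mueta crit Sp]]] :=
  gradient_bifurcation HT PT PH HP Psym Hsym Ssym K10 Spos Pv0 v00 Gq fG GH eta0.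
move: pq mueta; rewrite !lt_min => /andP[/andP[pd1 pd2] _] /andP[_ mue].
have cfp : collision_free p by apply: cf1; rewrite /= distrC.
have Fp : `|F p - q| < e by apply: F2; rewrite /= distrC.
have : `|mu / U| < Num.min e t.
  by rewrite normrM normfV (gtr0_norm U0) ltr_pdivrMr// mulrC.
rewrite lt_min => /andP[mue1 mut].
pose s := t + mu / U.
have s_gt0 : 0 < s by move: mut; rewrite ltr_norml /s => /andP[]; lra.
have peq : gradU m p = - U *: SM_grad m s p.
  apply/eqP; rewrite -subr_eq0; apply/eqP; rewrite -[RHS]crit /G -addrA; congr (_ + _).
  rewrite scaleNr opprK /W /S /=; apply: matrix2P => i.
    rewrite [LHS]mxE SM_grad0 [RHS]mxE [X in _ = _ + X]mxE !xyblock0 -scalemxAl.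
    rewrite [X in _ = X + _]mxE !mass_mxE [(p - q) i 0]mxE [(- q) i 0]mxE q0 /s.
    by field; rewrite gt_eqF.
  rewrite [LHS]mxE SM_grad1 [RHS]mxE [X in _ = _ + X]mxE !xyblock1 -scalemxAl.
  by rewrite [X in _ = X + _]mxE mul0mx !mass_mxE [(0 : E) i 1]mxE; ring.
exists s, (F p); split=> //.
- by rewrite /s addrC addKr.
- exact: SBC_of_equation.
(* If the rescaled point were [q], then [p] would lie on the y-axis. As [S] sees only x-coordinates,
   [S (p - q)] would be 0, against the strict positivity in [Sp]. *)
apply: contraTneq Sp => Fpq; rewrite -leNgt.
have p0 i : p i 0 = 0.
  have : F p i 0 = 0 by rewrite Fpq.
  rewrite mxE => /eqP; rewrite mulf_eq0 invr_eq0 gt_eqF/=; first by move/eqP.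
  by rewrite sqrtr_gt0 mulr_gt0 ?invr_gt0// potential_gt0.
suff -> : S (p - q) = 0 by rewrite mxdot0l.
rewrite /S /=; apply: matrix2P => i; last by rewrite xyblock1 mul0mx !mxE.
by rewrite xyblock0 mass_mxE !mxE p0 q0 subrr mulr0.
Qed.

End BifurcationAtEigenvalue.

(** * The spectrum of a collinear configuration *)

Lemma mup_prod_XsubC {F : fieldType} {I : Type} (s : seq I) (d : I -> F) (x : F) :
  mup x (\prod_(i <- s) ('X - (d i)%:P)) = count (fun i => d i == x) s.
Proof.
elim: s => [|i s IH]; first by rewrite big_nil mupNroot// rootE hornerC oner_eq0.
rewrite big_cons mupM ?polyXsubC_eq0//; last exact/monic_neq0/monic_prod_XsubC.
by rewrite IH -[X in mup _ X]expr1 mup_XsubCX /=; case: eqP.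
Qed.

Lemma row_free_rowsub {F : fieldType} {k n : nat} (f : 'I_k -> 'I_n) (Q : 'M[F]_n) :
  injective f -> Q \in unitmx -> row_free (rowsub f Q).
Proof.
move=> finj Qu; apply/row_freeP; exists (invmx Q *m (rowsub f 1%:M)^T).
rewrite mulmxA mul_rowsub_mx mulmxV//; apply/matrixP => i j.
rewrite mxE (bigD1 (f i))//= !mxE eqxx mul1r big1 ?addr0.
  by rewrite (inj_eq finj) [j == i]eq_sym.
by move=> l /negPf li; rewrite !mxE [f i == l]eq_sym li mul0r.
Qed.

Section SymmetrizableSpectrum.
Import complex.
Context {R : realType} {n : nat}.
Local Notation toC := (map_mx (real_complex R)).

(** The spectral theorem over the complex numbers; a real symmetric matrix is hermitian, so its
    eigenvalues are real. The base change [Q] may remain complex, as only characteristic polynomials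
    and ranks are read off. *)
Lemma real_symmetric_diagonalizable (S : 'M[R]_n) : S^T = S ->
  exists Q (d : 'rV[R]_n), Q \in unitmx /\
    toC S = invmx Q *m diag_mx (toC d) *m Q.
Proof.
move=> Ssym.
have SCsym : toC S \is symmetricmx.
  apply/is_hermitianmxP; rewrite expr0 scale1r map_mx_id//.
  by apply/matrixP => i j; rewrite !mxE -{1}Ssym mxE.
have SCreal : toC S \is a realmx.
  by apply/mxOverP => i j; rewrite mxE; apply/complex_realP; exists (S i j).
have herm := realsym_hermsym SCsym SCreal.
have /orthomx_spectralP SE := hermitian_normalmx herm.
exists (spectralmx (toC S)), (map_mx (@complex.Re R) (spectral_diag (toC S))).
split; first exact: spectral_unit.
rewrite {1}SE; congr (_ *m diag_mx _ *m _).
apply/matrixP => i j; rewrite !mxE.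
have /mxOverP/(_ i j) := hermitian_spectral_diag_real herm.
by move=> /RRe_real ->.
Qed.

(** Both conclusions descend to the reals: embedding polynomials is injective and ranks survive
    field extension. The rows of [Q] at the indices [j] with [d 0 j = eta] are independent
    eigenvectors. *)
Lemma diagonalizable_spectrum (A : 'M[R]_n) Q (d : 'rV[R]_n) : Q \in unitmx ->
  toC A = invmx Q *m diag_mx (toC d) *m Q ->
  char_poly A = \prod_j ('X - (d 0 j)%:P) /\
  forall eta, (#|[pred j | (d 0%R j == eta)%R]| <= \rank (eigenspace A eta))%N.
Proof.
move=> Qu AE; split.
  apply: (map_poly_inj (real_complex R : {rmorphism R -> R[i]})).
  rewrite map_char_poly AE rmorph_prod /=.
  have -> : \prod_(i < n) map_poly (real_complex R) ('X - (d 0 i)%:P) =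
      char_poly (diag_mx (toC d)).
    rewrite char_poly_trig ?diag_mx_is_trig//; apply: eq_bigr => i _.
    by rewrite rmorphB /= map_polyX map_polyC /= !mxE eqxx mulr1n.
  rewrite /char_poly /char_poly_mx.
  have -> : 'X%:M - map_mx polyC (invmx Q *m diag_mx (toC d) *m Q) =
     map_mx polyC (invmx Q) *m ('X%:M - map_mx polyC (diag_mx (toC d))) *m map_mx polyC Q.
    rewrite mulmxBr mulmxBl -!map_mxM; congr (_ - _).
    rewrite scalar_mxC -mulmxA -map_mxM mulVmx// map_mx1 mulmx1//.
  rewrite !det_mulmx mulrAC -det_mulmx -map_mxM mulVmx// map_mx1 det1 mul1r//.
move=> eta; set J := [pred j | _].
pose f (k : 'I_#|J|) : 'I_n := enum_val k.
have free : row_free (rowsub f Q) by apply: row_free_rowsub => //; exact: enum_val_inj.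
rewrite -[X in (X <= _)%N](eqP free) /eigenspace -(mxrank_map (real_complex R)) map_kermx.
apply: mxrankS; rewrite sub_kermx map_mxB map_scalar_mx /= mulmxBr AE.
rewrite !mulmxA mul_rowsub_mx mulmxV// mul_rowsub_mx mul1mx mul_rowsub_mx.
rewrite subr_eq0 mul_mx_scalar; apply/eqP/matrixP => i j.
have fi : d 0 (f i) = eta by have := enum_valP i; rewrite inE => /eqP.
by rewrite mul_diag_mx !mxE fi.
Qed.
Lemma invmx_mul (F : fieldType) k (A B : 'M[F]_k) :
  A \in unitmx -> B \in unitmx -> invmx (A *m B) = invmx B *m invmx A.
Proof.
move=> Au Bu; have ABu : A *m B \in unitmx by rewrite unitmx_mul Au.
rewrite -[RHS]mul1mx -(mulVmx ABu) -!mulmxA [B *m _]mulmxA mulmxV// mul1mx.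
by rewrite mulmxV// mulmx1.
Qed.

(* Conjugating by the square root of the mass matrix makes it symmetric. *)
Lemma MB_mx_spectrum (m : 'I_n -> R) (q : 'M[R]_(n, 2)) : (forall i, 0 < m i) ->
  (B_mx m q)^T = B_mx m q -> exists d : 'rV[R]_n,
  char_poly (MB_mx m q) = \prod_j ('X - (d 0 j)%:P) /\
  forall eta, (#|[pred j | (d 0%R j == eta)%R]| <= \rank (eigenspace (MB_mx m q) eta))%N.
Proof.
move=> m0 Bsym; pose W := diag_mx (\row_i Num.sqrt (m i)).
have WT : W^T = W by exact: tr_diag_mx.
have WW : mass_mx m = W *m W.
  rewrite /W mulmx_diag; congr diag_mx; apply/rowP => i.
  by rewrite !mxE -expr2 sqr_sqrtr// ltW.
have Wu : W \in unitmx.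
  rewrite unitmxE det_diag unitfE; apply/prodf_neq0 => i _.
  by rewrite mxE gt_eqF// sqrtr_gt0.
pose S := invmx W *m B_mx m q *m invmx W.
have ST : S^T = S by rewrite /S !trmx_mul trmx_inv WT Bsym mulmxA.
have MBE : MB_mx m q = invmx W *m S *m W.
  by rewrite /MB_mx WW invmx_mul// /S -!mulmxA mulVmx// mulmx1.
clearbody S; have [Q [d [Qu SE]]] := real_symmetric_diagonalizable ST.
have WCu : toC W \in unitmx by rewrite map_unitmx.
exists d; apply: (@diagonalizable_spectrum _ (Q *m toC W)).
  by rewrite unitmx_mul Qu.
by rewrite MBE !map_mxM SE map_invmx invmx_mul// !mulmxA.
Qed.

End SymmetrizableSpectrum.

(** * Conley's bound on the nonzero eigenvalues *)

Section CollinearEigenvalues.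
Context {R : realType} {n : nat}.
Variable m : 'I_n -> R.
Hypothesis m_gt0 : forall i, 0 < m i.
Implicit Types y z : 'I_n -> R.

(** Entry [i] of [M_0^-1 B] applied to [z], for masses at heights [y] on the axis. Functions replace
    vectors because the argument compares signs term by term. *)
Definition laplacian y z (i : 'I_n) : R :=
  \sum_(j | j != i) m j / `|y i - y j| ^+ 3 * (z j - z i).

(* [z] is constant between two of its points [i, j] with the same value, and
   those outside are seen at a closer range by the end on their side. *)
Lemma laplacian_monotone y z i j : injective y -> y i < y j -> z i = z j ->
  (forall a b, y a < y b -> z a <= z b) ->
  laplacian y z i <= laplacian y z j /\
  (laplacian y z i = laplacian y z j -> forall a, z a = z i).
Proof.
move=> yinj yij zij zmono.
have nij : i != j by apply: contraTneq yij => ->; rewrite ltxx.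
pose w a b : R := (`|y a - y b| ^+ 3)^-1.
have lapE k : z k = z i ->
    laplacian y z k = \sum_(a | (a != i) && (a != j)) m a * w k a * (z a - z i).
  move=> zk; rewrite /laplacian (bigID (fun a => (a != i) && (a != j))) /=.
  rewrite [X in _ + X]big1 ?addr0 => [|a /andP[_]]; last first.
    rewrite -negb_or negbK zk => /orP[] /eqP->.
      by rewrite subrr mulr0.
    by rewrite zij subrr mulr0.
  rewrite big_mkcond [RHS]big_mkcond /=; apply: eq_bigr => a _.
  case: (a != i) (a != j) => -[]; rewrite ?andbF ?andbT//=.
  case: eqVneq => //= [->|_]; last by rewrite zk.
  by rewrite zk subrr mulr0.
have wlt a b c : y a != y c -> `|y b - y c| > `|y a - y c| -> w b c < w a c.
  move=> ac bc; rewrite /w ltf_pV2 ?posrE ?exprn_gt0//.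
  - by rewrite ltrXn2r.
  - by rewrite (le_lt_trans _ bc).
  - by rewrite normr_gt0 subr_eq0.
have term a : a != i -> a != j ->
    0 <= m a * (w j a - w i a) * (z a - z i) /\
    (m a * (w j a - w i a) * (z a - z i) = 0 -> z a = z i).
  move=> ai aj.
  have yai : y a != y i by rewrite (inj_eq yinj).
  have yaj : y a != y j by rewrite (inj_eq yinj).
  have [lt_ai|lt_ia|] := ltgtP (y a) (y i); last by move/eqP; rewrite (negPf yai).
    have wji : w j a < w i a.
      apply: wlt; first by rewrite eq_sym.
      rewrite !gtr0_norm ?subr_gt0// ?ltrD2r//; exact: lt_trans yij.
    have zai := zmono _ _ lt_ai.
    have neg : m a * (w j a - w i a) < 0 by rewrite pmulr_rlt0// subr_lt0.
    split; first by rewrite mulr_le0// ?(ltW neg)// subr_le0.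
    by move/eqP; rewrite mulf_eq0 lt_eqF//= subr_eq0 => /eqP.
  have [lt_aj|lt_ja|] := ltgtP (y a) (y j); last by move/eqP; rewrite (negPf yaj).
    have -> : z a = z i.
      by apply/eqP; rewrite eq_le (zmono _ _ lt_ia) zij (zmono _ _ lt_aj).
    by rewrite subrr mulr0.
  have wij : w i a < w j a.
    apply: wlt; first by rewrite eq_sym.
    rewrite ![`|_ - y a|]distrC !gtr0_norm ?subr_gt0// ?ltrD2l ?ltrN2//.
  have zia := zmono _ _ lt_ia.
  have pos : 0 < m a * (w j a - w i a) by rewrite mulr_gt0// subr_gt0.
  split; first by rewrite mulr_ge0// ?(ltW pos)// subr_ge0.
  by move/eqP; rewrite mulf_eq0 gt_eqF//= subr_eq0 => /eqP.
have diffE : laplacian y z j - laplacian y z i =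
    \sum_(a | (a != i) && (a != j)) m a * (w j a - w i a) * (z a - z i).
  rewrite (lapE i)// (lapE j)// -sumrB; apply: eq_bigr => a _; ring.
split.
  rewrite -subr_ge0 diffE; apply: sumr_ge0 => a /andP[ai aj].
  by case: (term a ai aj).
move=> lapij a.
have [->//|ai] := eqVneq a i; have [->//|aj] := eqVneq a j.
have /eqP : laplacian y z j - laplacian y z i = 0 by rewrite lapij subrr.
rewrite diffE psumr_eq0 => [|b /andP[bi bj]]; last by case: (term b bi bj).
move=> /allP/(_ a); rewrite mem_index_enum ai aj /= => /(_ isT)/eqP.
by case: (term a ai aj).
Qed.

Lemma laplacianB y (k : R) z1 z2 i :
  laplacian y (fun a => k * z1 a - z2 a) i = k * laplacian y z1 i - laplacian y z2 i.
Proof.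
rewrite /laplacian mulr_sumr -sumrB; apply: eq_bigr => j _; ring.
Qed.

(* Conley: comparing an eigenvector with the eigenvector [y] through their
   largest ratio of increments. *)
Lemma laplacian_eigenvalue y x (U eta : R) : 0 < U -> injective y ->
  (forall i, laplacian y y i = - U * y i) ->
  (forall i, laplacian y x i = eta * x i) ->
  (exists a b, x a != x b) ->
  eta <= - U /\ (eta = - U -> exists k, forall i, x i = k * y i).
Proof.
move=> U0 yinj Ly.
(* Up to the sign of [x], some increment of [x] has the sign of the corresponding increment of [y];
   the maximal ratio [k] is then positive. *)
wlog : x / exists a b, y a < y b /\ x a < x b.
  move=> wl Lx [a [b xab]].
  wlog yab : a b xab / y a < y b.
    move=> wl2; have [|yba|/yinj ab] := ltgtP (y a) (y b); first exact: wl2.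
      by apply: (wl2 b a) => //; rewrite eq_sym.
    by rewrite ab eqxx in xab.
  have [lt_ab|lt_ba|] := ltgtP (x a) (x b); last by move/eqP; rewrite (negPf xab).
    by apply: (wl x) => //; [exists a, b|exists a, b].
  have := wl (fun i => - x i); case.
  - by exists a, b; rewrite ltrN2.
  - move=> i; have := laplacianB y 0 x x i; rewrite mul0r sub0r Lx => e.
    rewrite mulrN -e; apply: eq_bigr => j _; ring.
  - by exists a, b; rewrite eqr_opp.
  move=> h1 h2; split=> // /h2[k xk]; exists (- k) => i.
  by rewrite -[LHS]opprK xk mulNr.
move=> [a [b [yab xab]]] Lx _.
pose F (p : 'I_n * 'I_n) := (x p.2 - x p.1) / (y p.2 - y p.1).
pose D (p : 'I_n * 'I_n) := y p.1 < y p.2.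
have Dab : D (a, b) by [].
case: (@Order.TotalTheory.arg_maxP _ _ _ (a, b) D F Dab) => -[i j] Dij Fmax.
rewrite /D /= in Dij.
set k := F (i, j) in Fmax.
have k0 : 0 < k.
  by apply: lt_le_trans (Fmax (a, b) Dab); rewrite divr_gt0 ?subr_gt0.
(* Maximality of [k] says that [z] is nondecreasing along the axis, with equal values at the
   maximizing pair: the situation of [laplacian_monotone]. *)
pose z l := k * y l - x l.
have zmono c d : y c < y d -> z c <= z d.
  move=> ycd; have := Fmax (c, d) ycd; rewrite /F /= ler_pdivrMr ?subr_gt0// /z.
  lra.
have xij : x j - x i = k * (y j - y i).
  by rewrite /k /F /= divfK// gt_eqF// subr_gt0.
have zij : z i = z j by rewrite /z; lra.
have [lapz eqz] := laplacian_monotone yinj Dij zij zmono.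
have dE : laplacian y z j - laplacian y z i = - (k * (y j - y i)) * (U + eta).
  rewrite !laplacianB !Ly !Lx.
  have -> : k * (- U * y j) - eta * x j - (k * (- U * y i) - eta * x i) =
    - U * (k * (y j - y i)) - eta * (x j - x i) by ring.
  by rewrite xij; ring.
have kd : 0 < k * (y j - y i) by rewrite mulr_gt0// subr_gt0.
have etaU : eta <= - U.
  move: lapz; rewrite -subr_ge0 dE mulNr oppr_ge0 pmulr_rle0// => h; lra.
split=> // etaE; exists k.
have {}eqz := eqz _.
have zc : forall l, z l = z i.
  by apply: eqz; apply/eqP; rewrite eq_sym -subr_eq0 dE etaE subrr mulr0.
(* In the equality case [z] is constant and solves the eigenvalue equation for [- U]. The Laplacian
   of a constant is 0, so [z] vanishes and [x] is [k] times [y]. *)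
have Lz : laplacian y z i = 0.
  by rewrite /laplacian big1// => l _; rewrite zc subrr mulr0.
have zi0 : z i = 0.
  move: Lz; rewrite laplacianB Ly Lx etaE => h.
  have : U * z i = 0 by rewrite /z -oppr0 -h; ring.
  by move/eqP; rewrite mulf_eq0 gt_eqF//= => /eqP.
by move=> l; have := zc l; rewrite zi0 /z => /eqP; rewrite subr_eq0 => /eqP.
Qed.

End CollinearEigenvalues.

(** The bound [b] ensures that a supremum exists, so that [supremum] does not fall back on its
    default value. *)
Lemma le_supremum_nat (A : set nat) (b a : nat) :
  (forall x, A x -> (x <= b)%N) -> A a -> (a <= supremum 0%N A)%N.
Proof.
move=> Ab Aa; rewrite -leEnat; apply: ge_supremum_Nmem => //.
by apply: nat_supremums_neq0; exists b => x /Ab; rewrite -leEnat.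
Qed.

Lemma cvg_dist_harmonic {R : realType} {V : normedModType R} (u : nat -> V)
    (x : V) (c : R) : (forall l, `|u l - x| < c * harmonic l) -> u @ \oo --> x.
Proof.
move=> ux; apply/cvgrPdist_lt => e e0.
have h : (fun l => c * harmonic l) @ \oo --> (0 : R).
  by rewrite -(mulr0 c); apply: cvgMr; exact: cvg_harmonic.
have /cvgrPdist_lt/(_ _ e0) := h; apply: filterS => l.
rewrite sub0r normrN distrC => /(le_lt_trans (ler_norm _)).
exact: lt_trans (ux l).
Qed.

Section SpectrumOfCSBC.
Context {R : realType} {n : nat}.
Variable m : 'I_n -> R.
Hypothesis m_gt0 : forall i, 0 < m i.
Hypothesis n_ge2 : (2 <= n)%N.
Variables (q : 'M[R]_(n, 2)) (s0 : R).
Hypothesis q0 : forall i, q i 0 = 0.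
Hypothesis sbc : SBC m s0 q.
Let y i := q i 1.
Let U := potential m q.

Lemma CSBC_potential_gt0 : 0 < U.
Proof. by have [[_ cf _] _] := sbc; exact: potential_gt0. Qed.

Lemma CSBC_injective : injective y.
Proof.
have [[_ cf _] _] := sbc.
move=> i j yij; apply/eqP; apply: contraT => /cf/eqP[].
apply/matrixP => a k; rewrite !mxE.
have [->|k1] := eqVneq k 0; first by rewrite !q0.
by have -> : k = 1 by apply: val_inj; case: k k1 => -[|[|]].
Qed.

Lemma B_mx_laplacian (x : 'cV[R]_n) i :
  (B_mx m q *m x) i 0 = m i * laplacian m y (fun i => x i 0) i.
Proof.
rewrite B_mxE mulr_sumr; apply: eq_bigr => j _.
by rewrite collinear_dist// !mulrA.
Qed.

Lemma CSBC_laplacian i : laplacian m y y i = - U * y i.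
Proof.
have n_gt0 : (0 < n)%N by exact: leq_trans n_ge2.
have /matrixP/(_ i 1) := SBC_equation m_gt0 n_gt0 sbc.
rewrite [RHS]mxE SM_grad1 mxE => e.
apply: (mulfI (lt0r_neq0 (m_gt0 i))); rewrite [RHS]mulrCA -[RHS]e mulr_sumr.
by apply: eq_bigr => j _; rewrite collinear_dist// exprVn /y; ring.
Qed.

Lemma mass_mx_unit : mass_mx m \in unitmx.
Proof.
rewrite unitmxE det_diag unitfE; apply/prodf_neq0 => i _.
by rewrite mxE gt_eqF.
Qed.

(** Eigenvectors are row vectors in MathComp. As [B] and [M_0] are symmetric, [x = M_0^-1 v^T]
    passes to the generalized problem [B x = eta M_0 x]. *)
Lemma MB_eigenvector (v : 'rV[R]_n) eta : v *m MB_mx m q = eta *: v ->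
  exists x : 'cV[R]_n, [/\ v = x^T *m mass_mx m,
    B_mx m q *m x = eta *: (mass_mx m *m x) &
    forall i, laplacian m y (fun i => x i 0) i = eta * x i 0].
Proof.
move=> veta; have Mu := mass_mx_unit.
pose x := invmx (mass_mx m) *m v^T.
have Mx : mass_mx m *m x = v^T by rewrite /x mulKVmx.
have Bx : B_mx m q *m x = eta *: (mass_mx m *m x).
  apply: trmx_inj; rewrite Mx linearZ /= trmxK -veta trmx_mul B_mx_sym.
  by rewrite /x trmx_mul trmxK trmx_inv mass_mx_sym /MB_mx mulmxA.
exists x; split=> //; first by rewrite -mass_mx_sym -trmx_mul Mx trmxK.
move=> i; apply: (mulfI (lt0r_neq0 (m_gt0 i))).
by rewrite -B_mx_laplacian Bx mxE mass_mxE mulrCA.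
Qed.

Lemma eigenvector_nonconstant (x : 'cV[R]_n) : (exists a b, x a 0 != x b 0) \/
  exists c, forall i, x i 0 = c.
Proof.
have [[a [b h]]|h] := pselect (exists a b, x a 0 != x b 0); first by left; exists a, b.
right; exists (x (Ordinal (leq_trans (isT : (0 < 2)%N) n_ge2)) 0) => i.
by apply/eqP; apply: contraT => h'; case: h; exists i; eexists; exact: h'.
Qed.

Lemma MB_eigenvalue_cases eta : eigenvalue (MB_mx m q) eta ->
  [\/ eta = 0, eta = - U | eta < - U].
Proof.
move=> /eigenvalueP[v veta v0].
have [x [vx _ Lx]] := MB_eigenvector veta.
have [nc|[c xc]] := eigenvector_nonconstant x.
  have [h _] := laplacian_eigenvalue m_gt0 CSBC_potential_gt0 CSBC_injective CSBC_laplacian Lx nc.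
  move: h; rewrite le_eqVlt => /orP[/eqP h|h].
    by apply: Or32.
  by apply: Or33.
apply: Or31; apply/eqP; apply: contraT => eta0; move: v0.
suff x00 : x = 0 by rewrite vx x00 trmx0 mul0mx eqxx.
apply/matrixP => i j; rewrite ord1 mxE.
have := Lx i; rewrite /laplacian big1 => [|k _]; last by rewrite !xc subrr mulr0.
by move=> /esym/eqP; rewrite mulf_eq0 (negPf eta0) => /eqP.
Qed.

(** By Conley's bound a nonconstant solution for [eta = 0] would give [0 <= - U], and one for
    [eta = - U] is a multiple of [y]. Constants solve the equation for [- U] only when they are
    0. *)
Lemma rank_eigenspace_le1 eta : eta = 0 \/ eta = - U ->
  (\rank (eigenspace (MB_mx m q) eta) <= 1)%N.
Proof.
move=> etaE; have U0 := CSBC_potential_gt0.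
suff [u hu] : exists u : 'cV[R]_n, forall x : 'cV[R]_n,
    (forall i, laplacian m y (fun i => x i 0) i = eta * x i 0) -> exists k, x = k *: u.
  apply: leq_trans (rank_leq_row (u^T *m mass_mx m)); apply: mxrankS.
  apply/row_subP => i.
  have : row i (eigenspace (MB_mx m q) eta) *m MB_mx m q =
     eta *: row i (eigenspace (MB_mx m q) eta) by apply/eigenspaceP; exact: row_sub.
  move=> /MB_eigenvector[x [-> _ /hu[k ->]]].
  by rewrite linearZ /= -scalemxAl scalemx_sub.
case: etaE => ->.
  exists (const_mx 1) => x Lx.
  have [nc|[c xc]] := eigenvector_nonconstant x; last first.
    by exists c; apply/matrixP => i j; rewrite !mxE ord1 mulr1.
  have [h _] := laplacian_eigenvalue m_gt0 U0 CSBC_injective CSBC_laplacian Lx nc.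
  by move: h; rewrite oppr_ge0 leNgt U0.
exists (\col_i y i) => x Lx.
have [nc|[c xc]] := eigenvector_nonconstant x.
  have [_ /(_ erefl)[k xk]] := laplacian_eigenvalue m_gt0 U0 CSBC_injective CSBC_laplacian Lx nc.
  by exists k; apply/matrixP => i j; rewrite !mxE ord1.
exists 0; rewrite scale0r; apply/matrixP => i j; rewrite ord1 mxE.
have := Lx i; rewrite /laplacian big1 => [|k _]; last by rewrite !xc subrr mulr0.
by move=> /esym/eqP; rewrite mulf_eq0 oppr_eq0 (gt_eqF U0) => /eqP.
Qed.

Lemma MB_mup_le eta : (mup eta (char_poly (MB_mx m q)) <= n)%N.
Proof.
have [d [-> _]] := MB_mx_spectrum m_gt0 (B_mx_sym m q).
rewrite mup_prod_XsubC (leq_trans (count_size _ _))//.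
by rewrite -sum1_size sum_nat_const card_ord muln1.
Qed.

Lemma mup_le_alpha_star eta : eigenvalue (MB_mx m q) eta -> eta < - U ->
  (mup eta (char_poly (MB_mx m q)) <= alpha_star m q)%N.
Proof.
move=> ev lt; apply: (@le_supremum_nat _ n); last by exists eta.
by move=> _ [e _ <-]; exact: MB_mup_le.
Qed.

Lemma alpha_star_le : (alpha_star m q <= n)%N.
Proof.
rewrite /alpha_star; set A := [set _ | _ in _].
have [->|A0] := eqVneq A set0; first by rewrite supremum0.
rewrite /supremum (negPf A0).
have : supremums A !=set0.
  by apply: nat_supremums_neq0; exists n => _ [e _ <-]; exact: MB_mup_le.
case=> z Az; case: xgetP => [_ -> [_ h]|/(_ z)//].
by apply: h => _ [e _ <-]; exact: MB_mup_le.
Qed.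

(** The diagonal entries [d] link the two notions of multiplicity: the number of [j] with
    [d 0 j = eta] is at most the dimension of the eigenspace, which handles 0 and [- U], and it
    equals the root multiplicity used in [alpha_star]. *)
Lemma low_eigenvalues : exists L : seq R, [/\ uniq L,
  forall eta, eta \in L -> eigenvalue (MB_mx m q) eta /\ eta < - U &
  (n - 2 <= size L * alpha_star m q)%N].
Proof.
have [d [charE dimE]] := MB_mx_spectrum m_gt0 (B_mx_sym m q).
have ev j : eigenvalue (MB_mx m q) (d 0 j).
  rewrite eigenvalue_root_char charE /root horner_prod; apply/eqP.
  by rewrite (bigD1 j)//= hornerXsubC subrr mul0r.
pose L := undup [seq d 0 j | j <- enum 'I_n & d 0 j < - U].
have LP eta : eta \in L -> exists2 j, eta = d 0 j & d 0 j < - U.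
  by rewrite mem_undup => /mapP[j]; rewrite mem_filter => /andP[h _] ->; exists j.
exists L; split; first exact: undup_uniq.
  by move=> eta /LP[j -> h].
have card_le1 eta : eta = 0 \/ eta = - U -> (\sum_(j < n) (d 0%R j == eta)%R <= 1)%N.
  move=> h; apply: leq_trans (rank_eigenspace_le1 h).
  by apply: leq_trans (dimE eta); rewrite -sum1_card [leqRHS]big_mkcond.
have low_ge : (n - 2 <= \sum_(j < n) (d 0%R j < - U)%R)%N.
  have k1 : (n <= \sum_(j < n) ((d 0%R j < - U)%R + ((d 0%R j == 0)%R + (d 0%R j == - U)%R)))%N.
    rewrite -[X in (X <= _)%N]card_ord -sum1_card; apply: leq_sum => j _.
    by case: (MB_eigenvalue_cases (ev j)) => [->|->|->]; rewrite ?eqxx ?addnA ?addn1 ?addn0 ?ltnS ?add0n.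
  rewrite leq_subLR addnC (leq_trans k1)// !big_split /= leq_add2l.
  exact: (leq_add (card_le1 0 (or_introl erefl)) (card_le1 (- U) (or_intror erefl))).
apply: leq_trans low_ge _.
apply: (@leq_trans (\sum_(eta <- L) \sum_(j < n) (d 0%R j == eta)%R)%N).
  rewrite exchange_big /=; apply: leq_sum => j _.
  case jlow: (d 0 j < - U) => //.
  have jL : d 0 j \in L.
    by rewrite mem_undup; apply/mapP; exists j => //; rewrite mem_filter jlow mem_enum.
  by rewrite (big_rem _ jL) /= eqxx.
have LA eta : eta \in L -> (\sum_(j < n) (d 0%R j == eta)%R <= alpha_star m q)%N.
  move=> /LP[j -> jlow]; apply: leq_trans (mup_le_alpha_star (ev j) jlow).
  by rewrite charE mup_prod_XsubC -sum1_count [leqRHS]big_mkcond.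
rewrite big_seq; apply: (@leq_trans (\sum_(eta <- L | eta \in L) alpha_star m q)%N).
  exact: leq_sum.
by rewrite -big_seq big_const_seq count_predT iter_addn_0 mulnC.
Qed.

Lemma CSBC_bifurcations : exists L : seq R, [/\ uniq L,
  ((n - 2) %/ alpha_star m q <= size L)%N &
  forall t, t \in L -> 1 < t /\ forall s1 s2, s1 < t -> t < s2 ->
    bifurcation_instant m `[s1, s2] q t].
Proof.
have U0 := CSBC_potential_gt0.
have [L [Lu LP Lsize]] := low_eigenvalues.
exists [seq - eta / U | eta <- L]; split.
- rewrite map_inj_uniq// => a b /(congr1 ( *%R^~ U)).
  by rewrite !divfK ?gt_eqF// => /oppr_inj.
(* For [alpha_star m q = 0] the quotient is 0 by the convention on division by zero. *)
- rewrite size_map; have [->|a0] := posnP (alpha_star m q); first by rewrite divn0.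
  by rewrite -(mulnK (size L) a0) leq_div2r.
move=> _ /mapP[eta /LP[ev eta_lt] ->].
set t := - eta / U.
have t1 : 1 < t by rewrite ltr_pdivlMr// mul1r ltrNr.
split=> // s1 s2 s1t ts2; split; first by rewrite /= in_itv/= !ltW.
have /eigenvalueP[v veta v0] := ev.
have [x [vx Bx _]] := MB_eigenvector veta.
have x00 : x != 0 by apply: contraNneq v0 => x0; rewrite vx x0 trmx0 mul0mx.
have ker : B_mx m q *m x + (t * U) *: (mass_mx m *m x) = 0.
  by rewrite Bx /t divfK ?gt_eqF// -scalerDl subrr scale0r.
(* Errors below [c / (l + 1)] keep all parameters inside the interval and make both sequences
   converge. *)
pose c := Num.min (t - s1) (s2 - t).
have c0 : 0 < c by rewrite lt_min !subr_gt0 s1t.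
have ch0 l : 0 < c * harmonic l by rewrite mulr_gt0// harmonic_gt0.
have bif l := bifurcating_SBC m_gt0 n_ge2 q0 sbc (lt_trans ltr01 t1) x00 ker (ch0 l).
have [sq sqP] := choice (fun l => let: ex_intro s (ex_intro q' h) := bif l in
  ex_intro (fun z : R * 'M[R]_(n, 2) => [/\ `|z.1 - t| < c * harmonic l,
     `|z.2 - q| < c * harmonic l, SBC m z.1 z.2 & z.2 != q]) (s, q') h).
exists (fun l => (sq l).1), (fun l => (sq l).2); split.
- move=> l; have [h _ _ _] := sqP l.
  have {}h : `|(sq l).1 - t| < c.
    by apply: lt_le_trans h _; rewrite ler_piMr ?(ltW c0)// /harmonic/= invf_le1// ler1n.
  move: h; rewrite lt_min !ltr_norml => /andP[/andP[h1 _] /andP[_ h2]].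
  by rewrite /= in_itv/=; lra.
- by apply: (@cvg_dist_harmonic _ _ _ _ c) => l; have [] := sqP l.
- by apply: (@cvg_dist_harmonic _ 'M[R]_(n, 2) _ _ c) => l; have [] := sqP l.
- by move=> l; have [] := sqP l.
Qed.

End SpectrumOfCSBC.

(** * Existence of collinear configurations *)

(** Fermat's rule along a single direction, because minimality will be known only for displacements
    along the y-axis. *)
Lemma sdiff_local_min {R : realType} {m n : nat} (f : 'M[R]_(m, n) -> R) p G v
    (rho : R) : sdiff f p G -> 0 < rho ->
  (forall t : R, `|t| < rho -> f p <= f (p + t *: v)) -> mxdot G v = 0.
Proof.
move=> fG rho0 fmin; set g := mxdot G v.
apply/eqP; apply: contraT => g0; have ng : 0 < `|g| by rewrite normr_gt0.
have v1 : 0 < 1 + `|v| by rewrite ltr_pwDl.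
pose e := `|g| / (2 * (1 + `|v|)).
have e0 : 0 < e by rewrite divr_gt0// mulr_gt0.
have [d d0 dP] := near_ball_pair (fG _ e0).
pose tau := Num.min (rho / 2) (d / (2 * (1 + `|v|))).
have tau0 : 0 < tau by rewrite lt_min !divr_gt0// mulr_gt0.
pose t := - (tau * Num.sg g).
have nt : `|t| = tau by rewrite normrN normrM normr_sg g0 mulr1 gtr0_norm.
have tg : t * g = - (tau * `|g|) by rewrite /t normrEsg; ring.
have : `|t| < rho.
  rewrite nt; apply: (@le_lt_trans _ _ (rho / 2)); first by rewrite ge_min lexx.
  by rewrite ltr_pdivrMr// ltr_pMr// ltr1n.
move=> /fmin fle.
have tv : tau * (2 * (1 + `|v|)) <= d.
  by rewrite -ler_pdivlMr ?mulr_gt0// ge_min lexx orbT.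
have bd : `|p + t *: v - p| < d.
  rewrite [p + _]addrC addrK normrZ nt; apply: lt_le_trans tv.
  rewrite ltr_pM2l//; have := normr_ge0 v; lra.
have pd : `|p - p| < d by rewrite subrr normr0.
have := dP _ _ pd bd; rewrite /= [p + _]addrC addrK mxdotZr -/g tg normrZ nt.
rewrite ler_norml => /andP[_ h].
have : e * (tau * `|v|) <= tau * `|g| / 2.
  rewrite /e mulrCA -[leRHS]mulrA ler_wpM2l ?(ltW tau0)// mulrAC -mulrA.
  rewrite ler_wpM2l// ler_pdivrMr ?mulr_gt0//.
  have := normr_ge0 v; lra.
have : 0 < tau * `|g| by rewrite mulr_gt0.
rewrite addrC in fle; lra.
Qed.

Section Moulton.
Context {R : realType} {n : nat}.
Variable m : 'I_n -> R.
Hypothesis m_gt0 : forall i, 0 < m i.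
Hypothesis n_ge2 : (2 <= n)%N.
Variable sigma : {perm 'I_n}.
Local Notation E := 'M[R]_(n, 2).
Implicit Types q v : E.

(** [sigma i] is the rank of mass [i] along the axis. The uniform lower bound on the gaps makes this
    part of the open cell closed. *)
Definition gaps_ge (delta r : R) : set E := [set q : E | [/\ forall i, q i 0 = 0,
  `|q| <= r & forall i j, (sigma i < sigma j)%N -> delta <= q j 1 - q i 1]].

Lemma ordered_collision_free q :
  (forall i j, (sigma i < sigma j)%N -> q i 1 < q j 1) -> collision_free q.
Proof.
move=> qlt i j ij.
have lt_row (a b : 'I_n) : (sigma a < sigma b)%N -> row a q != row b q.
  move=> /qlt lt; apply: contraTneq lt => /matrixP/(_ 0 1); rewrite !mxE => ->.
  by rewrite ltxx.
have : sigma i != sigma j by rewrite (inj_eq perm_inj).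
rewrite neq_ltn => /orP[/lt_row//|/lt_row].
by rewrite eq_sym.
Qed.

Lemma gaps_ge_ordered delta r q : 0 < delta -> gaps_ge delta r q ->
  forall i j, (sigma i < sigma j)%N -> q i 1 < q j 1.
Proof.
by move=> d0 [_ _ gap] i j /gap h; rewrite -subr_gt0 (lt_le_trans d0).
Qed.

Lemma gaps_ge_compact delta r : compact (gaps_ge delta r).
Proof.
have cc i k : continuous (fun q : E => q i k) by exact: coord_continuous.
apply: bounded_closed_compact_mx.
  by exists r; split=> [|x rx q [_ qr _]] /=; rewrite ?num_real// (le_trans qr)// ltW.
have -> : gaps_ge delta r = (\bigcap_(i in @setT 'I_n) [set q : E | q i 0 = 0]) `&`
    [set q : E | `|q| <= r] `&`
    (\bigcap_(ij in [set ij : 'I_n * 'I_n | (sigma ij.1 < sigma ij.2)%N])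
      [set q : E | delta <= q ij.2 1 - q ij.1 1]).
  apply/seteqP; split=> q /=.
    by move=> [h1 h2 h3]; split; [split=> // i _; exact: h1|move=> ij; exact: h3].
  move=> [[h1 h2] h3]; split=> //; first by move=> i; exact: h1.
  by move=> i j ij; exact: (h3 (i, j)).
apply: closedI; first apply: closedI.
- apply: closed_bigI => i _.
  apply: (@closed_comp E R (fun q => q i 0) [set 0]); first by move=> q _; exact: cc.
  exact: closed_eq.
- exact: closed_mx_ball.
- apply: closed_bigI => ij _.
  apply: (@closed_comp E R (fun q => q ij.2 1 - q ij.1 1) [set x | delta <= x]).
    by move=> q _; apply: (@continuousB R R); exact: cc.
  exact: closed_ge.
Qed.

Lemma potential_pair_le q i j : collision_free q -> i != j ->
  m i * m j / dist q i j <= potential m q.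
Proof.
move=> cf.
have pos a b : a != b -> 0 <= m a * m b / dist q a b.
  by move=> ab; apply/ltW; rewrite divr_gt0 ?mulr_gt0// dist_gt0.
have pos2 (a : 'I_n) : 0 <= \sum_(b < n | (a < b)%N) m a * m b / dist q a b.
  by apply: sumr_ge0 => b ab; rewrite pos// neq_ltn ab.
wlog ij : i j / (i < j)%N.
  move=> wl nij; have := nij; rewrite neq_ltn => /orP[ij|ji]; first exact: wl.
  by rewrite distC [m i * _]mulrC wl// eq_sym.
move=> _; rewrite /potential (bigD1 i)//= (bigD1 j)//= -addrA lerDl addr_ge0//.
  by apply: sumr_ge0 => b /andP[ab _]; rewrite pos// neq_ltn ab.
by apply: sumr_ge0.
Qed.

(* The minimum of [U + |q|_M^2 / 2] over a compact piece of the cell of the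
   given ordering; [U] keeps it off the collisions and the quadratic part
   keeps it bounded. *)
Lemma collinear_SBC_exists : exists q, [/\ forall i, q i 0 = 0, SBC m 2 q &
  forall i j, (sigma i < sigma j)%N -> q i 1 < q j 1].
Proof.
pose W : {linear E -> E} := xyblock (1 *: mass_mx m) (mass_mx m).
have Wsym (a b : E) : mxdot (W a) b = mxdot a (W b).
  by rewrite /W /= xyblock_dot scale1r mass_mx_sym.
pose F (q : E) := potential m q + 2^-1 * mxdot (W (q - 0)) (q - 0).
have FE (q : E) : F q = potential m q + 2^-1 * SM_form m 1 q q.
  by rewrite /F subr0 SM_formE.
have Fsd (q : E) : collision_free q -> sdiff F q (gradU m q + W q).
  move=> cf.
  have := sdiffD (sdiff_potential m cf) (sdiffZ 2^-1 (sdiff_quadratic 0 q Wsym)).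
  by rewrite scalerA mulVf ?pnatr_eq0// scale1r subr0.
have msqr i (x : R) : 0 <= m i * x ^+ 2 by apply: mulr_ge0; [exact: ltW|exact: sqr_ge0].
have SM_ge (q : E) k : m k * q k 1 ^+ 2 <= SM_form m 1 q q.
  rewrite /SM_form (bigD1 k)//= mul1r mulrDr -!expr2 -addrA addrCA lerDl.
  apply: addr_ge0; first exact: msqr.
  by apply: sumr_ge0 => i _; rewrite mul1r -!expr2 mulrDr addr_ge0.
have SM0 (q : E) : 0 <= SM_form m 1 q q.
  have n_gt0 : (0 < n)%N by exact: leq_trans n_ge2.
  apply: le_trans (SM_ge q (Ordinal n_gt0)).
  exact: msqr.
pose qref : E := \matrix_(i, k) if k == 0 then 0 else (sigma i)%:R.
have qref_lt i j : (sigma i < sigma j)%N -> qref i 1 < qref j 1.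
  by move=> ij; rewrite !mxE /= ltr_nat.
have cfref := ordered_collision_free qref_lt.
pose c0 := F qref.
have c00 : 0 < c0.
  by rewrite /c0 FE ltr_pwDl ?potential_gt0// mulr_ge0.
have mi0 i : 0 <= (m i)^-1 by rewrite invr_ge0 ltW.
(* [Sg] and [Sm] replace a minimum over the masses: they give lower bounds for [m i * m j] and [m i]
   that are uniform in the indices. *)
pose Sg := \sum_i \sum_j (m i)^-1 * (m j)^-1.
have Sg_ge i j : 1 <= m i * m j * Sg.
  rewrite /Sg (bigD1 i)//= (bigD1 j)//= -addrA mulrDr.
  have -> : m i * m j * ((m i)^-1 * (m j)^-1) = 1.
    by rewrite mulrACA !divff ?gt_eqF// mulr1.
  rewrite lerDl mulr_ge0// ?mulr_ge0 ?(ltW (m_gt0 _))// addr_ge0 ?sumr_ge0//.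
    by move=> l _; rewrite mulr_ge0.
  by move=> k _; rewrite sumr_ge0// => l _; rewrite mulr_ge0.
have Sg0 : 0 <= Sg by do 2!(apply: sumr_ge0 => ? _); rewrite mulr_ge0.
pose Sm := \sum_i (m i)^-1.
have Sm0 : 0 <= Sm by apply: sumr_ge0.
have Sm_ge i : 1 <= m i * Sm.
  rewrite /Sm (bigD1 i)//= mulrDr divff ?gt_eqF// lerDl mulr_ge0 ?(ltW (m_gt0 _))//.
  by rewrite sumr_ge0.
have cS : 0 < 1 + c0 * Sg by rewrite ltr_pwDl// mulr_ge0// ltW.
(* Where [U <= c0], each gap is at least [1 / (c0 * Sg)], which exceeds [delta]. The added 1 gives
   strictness and [delta <= 1], so that the integer configuration [qref] is admissible. *)
pose delta := (1 + c0 * Sg)^-1; have delta0 : 0 < delta by rewrite invr_gt0.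
have delta1 : delta <= 1.
  by rewrite invf_le1// lerDl mulr_ge0// ltW.
(* [1 + n%:R] makes room for [qref]. If some [|y_k| >= r], then [y_k ^ 2 >= r] as [r >= 1], and the
   last summand pushes [m k * y_k ^ 2] beyond the bound [2 * c0] that [F q <= c0] imposes. *)
pose r := 1 + n%:R + 2 * c0 * Sm.
have r1 : 1 + n%:R <= r by rewrite lerDl !mulr_ge0// ltW.
have Dref : gaps_ge delta r qref.
  split=> [i| |i j ij]; first by rewrite mxE.
    apply: mx_norm_le => [|i k]; first by rewrite (le_trans _ r1).
    apply: le_trans r1; rewrite mxE; case: ifP => _; first by rewrite normr0.
    by rewrite normr_nat (le_trans (_ : _ <= n%:R)) ?lerDr// ler_nat ltnW.
  rewrite !mxE /= (le_trans delta1)// -natrB ?(ltnW ij)//.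
  by rewrite ler1n subn_gt0.
have cF : {within gaps_ge delta r, continuous F}.
  apply: continuous_in_subspaceT => q; rewrite inE => /(gaps_ge_ordered delta0) qlt.
  exact: (sdiff_continuous (Fsd _ (ordered_collision_free qlt))).
have D0 : gaps_ge delta r !=set0 by exists qref.
have [q] := compact_EVT_min D0 (@gaps_ge_compact delta r) cF.
rewrite inE => Dq qmin.
have qlt := gaps_ge_ordered delta0 Dq.
have cf := ordered_collision_free qlt.
have Fq : F q <= c0 by apply: qmin; rewrite inE.
have [q0 qr qgap] := Dq.
have Uq := potential_gt0 n_ge2 m_gt0 cf.
have strict_gap i j : (sigma i < sigma j)%N -> delta < q j 1 - q i 1.
  move=> ij; have g0 : 0 < q j 1 - q i 1 by rewrite subr_gt0 qlt.
  have nij : i != j by apply: contraTneq ij => ->; rewrite ltnn.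
  have := potential_pair_le cf nij.
  rewrite collinear_dist// distrC (gtr0_norm g0) ler_pdivrMr// => h1.
  have h2 : potential m q <= c0.
    by apply: le_trans Fq; rewrite FE lerDl mulr_ge0.
  have h3 : m i * m j <= c0 * (q j 1 - q i 1).
    by rewrite (le_trans h1)// ler_wpM2r// ltW.
  rewrite ltNge; apply/negP; rewrite /delta -div1r ler_pdivlMr// => h4.
  have := le_trans (Sg_ge i j) (ler_wpM2r Sg0 h3); lra.
have bounded k : `|q k 1| < r.
  rewrite ltNge; apply/negP => rk.
  have r0 : 1 <= r by rewrite (le_trans _ r1)// lerDl.
  have h1 : r <= q k 1 ^+ 2.
    rewrite -(real_normK (num_real (q k 1))) expr2.
    by rewrite (le_trans rk)// ler_peMl// (le_trans r0).
  have h2 : m k * q k 1 ^+ 2 <= 2 * c0.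
    have := Fq; have := SM_ge q k; rewrite FE; lra.
  have h3 : m k * r <= m k * q k 1 ^+ 2 by rewrite ler_pM2l.
  have h4 : 2 * c0 * 1 <= 2 * c0 * (m k * Sm) by rewrite ler_wpM2l ?Sm_ge// mulr_ge0// ltW.
  have h5 : 0 < m k * (1 + n%:R) by rewrite mulr_gt0// ltr_pwDl.
  have : m k * r = m k * (1 + n%:R) + 2 * c0 * (m k * Sm) by rewrite /r; ring.
  lra.
(* The strict inequalities are open conditions, so [q] is interior relative to the y-axis and
   vertical displacements are admissible. *)
have nearD : \forall p \near q, (forall i, (p : E) i 0 = 0) -> gaps_ge delta r p.
  pose Q1 k (p : E) := `|p k 1| < r.
  pose Q2 (ij : 'I_n * 'I_n) (p : E) :=
    (sigma ij.1 < sigma ij.2)%N -> delta < p ij.2 1 - p ij.1 1.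
  have H1 k : \forall p \near q, Q1 k p.
    have /cvgrPdist_lt/(_ (r - `|q k 1|)) := sdiff_continuous (sdiff_coord k 1 q).
    rewrite subr_gt0 => /(_ (bounded k)); apply: filterS => p.
    rewrite /Q1 distrC => h; have := ler_normD (p k 1 - q k 1) (q k 1).
    by rewrite subrK; lra.
  have H2 ij : \forall p \near q, Q2 ij p.
    case: ij => i j; rewrite /Q2 /=.
    have [ij|_] := boolP (sigma i < sigma j)%N; last by near=> p.
    have h : \forall p \near q, delta < (p : E) j 1 - p i 1.
      exact: (sdiff_continuous (sdiff_diff j i 1 q) (lt_nbhsr (strict_gap _ _ ij))).
    by near=> p => _; near: p; exact: h.
  have H1' : \forall p \near q, forall k, Q1 k p by exact: (@filter_forall _ _ Q1 _ _ H1).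
  have H2' : \forall p \near q, forall ij, Q2 ij p by exact: (@filter_forall _ _ Q2 _ _ H2).
  near=> p => p0; split=> //.
    have Q1p : forall k, Q1 k p by near: p; exact: H1'.
    apply: mx_norm_le => [|i k]; first by rewrite (le_trans _ r1).
    have [->|k1] := eqVneq k 0; first by rewrite p0 normr0 (le_trans _ r1).
    have -> : k = 1 by apply: val_inj; case: k k1 => -[|[|]].
    exact/ltW/Q1p.
  have Q2p : forall ij, Q2 ij p by near: p; exact: H2'.
  by move=> i j ij; apply/ltW; exact: (Q2p (i, j)).
have crit k : mxdot (gradU m q + W q) (delta_mx k 1) = 0.
  have /(@nbhs_normP R E)[d /= d0 dD] := nearD.
  apply: (sdiff_local_min (Fsd _ cf) d0) => t td.
  apply: qmin; rewrite inE; apply: dD => [|i] /=.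
    rewrite opprD addrA subrr add0r normrN normrZ.
    apply: le_lt_trans td; rewrite ler_piMr//; apply: mx_norm_le => // i j.
    by rewrite mxE; case: (_ && _); rewrite ?normr1 ?normr0.
  by rewrite !mxE q0 andbF mulr0 addr0.
(* In the horizontal components both sides vanish on the axis, whatever the parameter; 2 is one
   value above 1, as [CSBC1] asks for. *)
have eqn : gradU m q = - 1 *: SM_grad m 2 q.
  apply: matrix2P => i.
    rewrite [RHS]mxE SM_grad0 q0 !mulr0 mxE big1// => j _.
    by rewrite !q0 subrr !mulr0.
  rewrite [RHS]mxE SM_grad1; have := crit i.
  rewrite mxdotC mxdot_delta mxE /W /= xyblock1 mass_mxE; lra.
pose c := (Num.sqrt (1^-1 * potential m q))^-1.
have c_gt0 : 0 < c by rewrite invr_gt0 sqrtr_gt0 mulr_gt0// invr_gt0.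
exists (c *: q); split.
- by move=> i; rewrite mxE q0 mulr0.
- exact: SBC_of_equation.
- by move=> i j ij; rewrite !mxE ltr_pM2l// qlt.
Unshelve. all: by end_near. Qed.

End Moulton.

(** * Counting bifurcation instants *)

Local Open Scope card_scope.

Lemma card_le_uniq {T : pointedType} (l : seq T) (A : set T) (k : nat) :
  uniq l -> (forall x, x \in l -> A x) -> (k <= size l)%N -> `I_k #<= A.
Proof.
move=> lu lA kl.
have finj : {in `I_k &, injective (nth point l)}.
  move=> i j; rewrite !inE /= => ik jk /eqP.
  by rewrite nth_uniq ?(leq_trans _ kl)// => /eqP.
have /card_eqPle[_ h] := inj_card_eq finj.
apply: card_le_trans h _; apply: subset_card_le => _ [i ik <-].
by apply/lA/mem_nth; exact: leq_trans kl.
Qed.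

(** A finite list of numbers above 1 stays away from 1 and is bounded, so a single pair of constants
    serves all instants and, in the second part, all orderings. *)
Lemma parameter_bounds {R : realType} (l : seq R) : (forall t, t \in l -> 1 < t) ->
  exists eps K : R, [/\ 0 < eps, 1 + eps < K &
    forall t, t \in l -> 1 + eps <= t <= K].
Proof.
elim: l => [|a l IH] l1; first by exists 1, 3; split=> //; lra.
have [|eps [K [eps0 epsK lP]]] := IH; first by move=> t tl; apply: l1; rewrite inE tl orbT.
have a1 : 1 < a by apply: l1; rewrite mem_head.
exists (Num.min eps (a - 1)), (Num.max K a); split.
- by rewrite lt_min eps0 subr_gt0.
- rewrite lt_max; apply/orP; left; apply: le_lt_trans epsK.
  by rewrite lerD2l ge_min lexx.
move=> t; rewrite inE => /predU1P[->|/lP/andP[h1 h2]].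
  rewrite le_max lexx orbT andbT -lerBrDl ge_min lexx orbT//.
by rewrite le_max h2 andbT (le_trans _ h1)// lerD2l ge_min lexx.
Qed.

Section AlphaStar.
Context {R : realType} {n : nat}.
Variable m : 'I_n -> R.
Hypothesis m_gt0 : forall i, 0 < m i.
Hypothesis n_ge3 : (3 <= n)%N.
Implicit Types q : 'M[R]_(n, 2).

(** For [n >= 3] some eigenvalue lies below [- U]. Positivity is what allows replacing [alpha_star]
    by the larger [alpha_star_max] in a division, since dividing by 0 gives 0. *)
Lemma alpha_star_gt0 q : CSBC1 m q -> (0 < alpha_star m q)%N.
Proof.
move=> [q0 [s _ sbc]].
have [L [_ _ ]] := low_eigenvalues m_gt0 (ltnW n_ge3) q0 sbc.
by case: alpha_star => //; rewrite muln0 leqn0 subn_eq0 leqNgt n_ge3.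
Qed.

Lemma alpha_star_le_max q : CSBC1 m q -> (alpha_star m q <= alpha_star_max m)%N.
Proof.
move=> cq; apply: (@le_supremum_nat _ n); last by exists q.
by move=> _ [p _ <-]; exact: alpha_star_le.
Qed.

Lemma CSBC1_bifurcations q : CSBC1 m q -> exists L : seq R, [/\ uniq L,
  ((n - 2) %/ alpha_star m q <= size L)%N &
  forall t, t \in L -> 1 < t /\ forall s1 s2, s1 < t -> t < s2 ->
    bifurcation_instant m `[s1, s2] q t].
Proof.
by move=> [q0 [s _ sbc]]; exact: (CSBC_bifurcations m_gt0 (ltnW n_ge3) q0 sbc).
Qed.

(** The value of a permutation at [i] is the number of indices whose image lies below that of [i],
    so it is determined by the induced order. *)
Lemma perm_eq_of_order (sg tau : {perm 'I_n}) :
  (forall i j, (sg i < sg j)%N = (tau i < tau j)%N) -> sg = tau.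
Proof.
have count k : (\sum_(0 <= j < n) (j < k)%N)%N = minn n k.
  elim: (n) => [|l IH]; first by rewrite big_geq// min0n.
  by rewrite big_nat_recr //= IH; case: (ltnP l k) => /= lk; lia.
have rank (u : {perm 'I_n}) i : (\sum_(j < n) (u j < u i)%N)%N = u i.
  have -> : (\sum_(j < n) (u j < u i)%N)%N = (\sum_(j < n) (j < u i)%N)%N.
    by rewrite [RHS](reindex_inj (@perm_inj _ u)).
  rewrite -(big_mkord xpredT (fun j => (j < u i)%N : nat)) count.
  by apply/minn_idPr; exact: ltnW.
move=> ord; apply/permP => i; apply: val_inj.
rewrite /= -[LHS](rank sg) -[RHS](rank tau).
by apply: eq_bigr => j _; rewrite ord.
Qed.

(** The ordering can be read off the y-coordinates, so different orderings give different
    configurations; this supplies the factor [n!]. *)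
Lemma ordered_CSBC1 : exists Q : {perm 'I_n} -> 'M[R]_(n, 2),
  injective Q /\ forall sg, CSBC1 m (Q sg).
Proof.
have [Q QP] := choice (collinear_SBC_exists m_gt0 (ltnW n_ge3)).
exists Q; split.
  have ordP (sg : {perm 'I_n}) i j : (sg i < sg j)%N = (Q sg i 1 < Q sg j 1).
    have [_ _ lt] := QP sg.
    apply/idP/idP => [/lt//|]; apply: contraTT; rewrite -leqNgt -leNgt.
    rewrite leq_eqVlt => /predU1P[/val_inj/perm_inj->//|/lt/ltW//].
  by move=> sg tau Qe; apply: perm_eq_of_order => i j; rewrite !ordP Qe.
by move=> sg; have [q0 sbc _] := QP sg; split=> //; exists 2 => //; rewrite ltr1n.
Qed.

End AlphaStar.

Theorem theorem4p7 (R : realType) (n : nat) (m : 'I_n -> R)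
    (n_ge3 : (3 <= n)%N) (m_gt0 : forall i, 0 < m i) :
  (forall q : 'M[R]_(n, 2), CSBC1 m q ->
    exists eps K : R, [/\ 0 < eps, 1 + eps < K &
      forall s1 s2 : R, 1 < s1 -> s1 < 1 + eps -> K < s2 ->
        `I_((n - 2) %/ alpha_star m q)%N
          #<= [set sstar : R | bifurcation_instant m `[s1, s2] q sstar]])
  /\
  (exists eps K : R, [/\ 0 < eps, 1 + eps < K &
    forall s1 s2 : R, 1 < s1 -> s1 < 1 + eps -> K < s2 ->
      `I_(n`! * ((n - 2) %/ alpha_star_max m))%N
        #<= [set p : 'M[R]_(n, 2) * R |
              CSBC1 m p.1 /\ bifurcation_instant m `[s1, s2] p.1 p.2]]).
Proof.
have inside (eps K s1 s2 t : R) : s1 < 1 + eps -> K < s2 -> 1 + eps <= t <= K ->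
    s1 < t /\ t < s2.
  by move=> h1 h2 /andP[h3 h4]; split; lra.
split=> [q cq|].
  have [L [Lu Lsize LP]] := CSBC1_bifurcations m_gt0 n_ge3 cq.
  have [t /LP[]//|eps [K [eps0 epsK tP]]] := @parameter_bounds R L.
  exists eps, K; split=> // s1 s2 _ s1e Ks2.
  apply: card_le_uniq Lu _ Lsize => t tL.
  by have [st ts] := inside _ _ _ _ _ s1e Ks2 (tP _ tL); have [_] := LP t tL; apply.
have [Q [Qinj QC]] := ordered_CSBC1 m_gt0 n_ge3.
have [L LP] := choice (fun sg => CSBC1_bifurcations m_gt0 n_ge3 (QC sg)).
pose N := ((n - 2) %/ alpha_star_max m)%N.
have LN sg : (N <= size (L sg))%N.
  have [_ h _] := LP sg; apply: leq_trans h; apply: leq_div2l.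
    exact: alpha_star_gt0.
  exact: alpha_star_le_max.
(* Truncating each list to [N] entries makes the number of pairs exactly [n!] times [N]. *)
pose pairs := [seq (Q sg, t) | sg <- enum {perm 'I_n}, t <- take N (L sg)].
have pairsP p : p \in pairs -> exists sg t, [/\ p = (Q sg, t) & t \in L sg].
  by move=> /allpairsPdep[sg [t [_ tL ->]]]; exists sg, t; split=> //; exact: mem_take tL.
have [|eps [K [eps0 epsK tP]]] := @parameter_bounds R (map snd pairs).
  by move=> t /mapP[p /pairsP[sg [t' [-> tL]]] ->] /=; have [_ _ /(_ _ tL)[]] := LP sg.
exists eps, K; split=> // s1 s2 _ s1e Ks2.
apply: (@card_le_uniq _ pairs).
- apply: allpairs_uniq_dep.
  + exact: enum_uniq.
  + by move=> sg _; rewrite take_uniq//; have [] := LP sg.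
  + by move=> [sg t] [tau u] _ _ [/Qinj e ->]; rewrite e.
- move=> p pin; have [sg [t [pE tL]]] := pairsP p pin.
  have [_ _ /(_ _ tL)[_ bif]] := LP sg.
  have tin : t \in map snd pairs by apply/mapP; exists p => //; rewrite pE.
  have [st ts] := inside _ _ _ _ _ s1e Ks2 (tP _ tin).
  by rewrite pE; split; [exact: QC|exact: bif].
rewrite size_allpairs_dep sumnE big_map big_enum /=.
rewrite (eq_bigr (fun=> N)) => [|sg _]; last by rewrite size_takel.
by rewrite sum_nat_const card_Sn mulnC leqnn.
Qed.
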